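(* Let $v:\mathbb{T}\to\mathbb{R}$ be a real analytic function, $a:\mathbb{T}\to\mathbb{C}$ a complex analytic function that is not identically zero, and $\lambda_a,\lambda_v>0$. For any $0<\gamma<1$, $E\in\mathscr{E}$ and irrational $\omega$, there exists $\lambda_p=\lambda_p(\lambda_a,a,v,\gamma)$ (depending only on the listed data) such that if $\lambda_v>\lambda_p$, then $$L(E,\omega)>(1-\gamma)\log\lambda_v.$$
   Context: $\mathbb{T}=\mathbb{R}/\mathbb{Z}$. For irrational $\omega$, $E\in\mathbb{R}$ and $\lambda_v>0$ the Jacobi cocycle matrix is $$M(x,E,\omega)=\frac{1}{\lambda_aa(x+\omega)}\begin{pmatrix}\lambda_vv(x)-E&-\lambda_a\overline{a(x)}\\ \lambda_aa(x+\omega)&0\end{pmatrix}\ \text{(a.e. }x),$$ $M_n(x,E,\omega)=\prod_{k=n}^1M(x+k\omega,E,\omega)$ (index decreasing from left to right), and $L(E,\omega)=\lim_{n\to\infty}\frac1n\int_{\mathbb{T}}\log\|M_n(x,E,\omega)\|\,dx$ is the Lyapunov exponent. $\mathscr{E}=[-2\lambda_a\|a\|_{L^\infty(\mathbb{T})}-\lambda_v\|v\|_{L^\infty(\mathbb{T})},\,2\lambda_a\|a\|_{L^\infty(\mathbb{T})}+\lambda_v\|v\|_{L^\infty(\mathbb{T})}]$.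
   Formalization: The function v is additionally assumed non-constant; for constant v the claim fails (e.g. v = 1, a = 1, λ_a = 1, E = λ_v gives L = 0 for every λ_v). *)

(* Defs.v *)
From HB Require Import structures.
From mathcomp Require Import all_boot all_order all_algebra.
From mathcomp Require Import complex.
From mathcomp Require Import all_classical all_reals all_analysis.

Set Implicit Arguments.
Unset Strict Implicit.
Unset Printing Implicit Defensive.

Import Order.TTheory GRing.Theory Num.Theory numFieldNormedType.Exports.
Local Open Scope classical_set_scope.
Local Open Scope ring_scope.
Local Open Scope complex_scope.

(* Functions on the circle T = R/Z are 1-periodic functions on R, and
   integration over T is Lebesgue integration over [0, 1]. *)

(* [emb] is the embedding of R into the value field K: the identity for
   real-valued functions, [real_complex R] for complex-valued ones. *)
Definition has_local_power_series (R : realType) (K : numFieldType)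
    (emb : R -> K) (f : R -> K) : Prop :=
  forall x0 : R, exists (c : nat -> K) (r : R), 0 < r /\
    forall x : R, `|x - x0| < r ->
      series (fun k => c k * emb (x - x0) ^+ k) @ \oo --> f x.

Definition analytic_circle_real (R : realType) (v : R -> R) : Prop :=
  periodic v 1 /\ has_local_power_series id v.

Definition analytic_circle_complex (R : realType) (a : R -> R[i]) : Prop :=
  periodic a 1 /\ @has_local_power_series R R[i] (real_complex R) a.

(* The L^infty(T) norm; its argument is the pointwise modulus. *)
Definition Linfty_circle (R : realType) (f : R -> R) : R :=
  fine (Lnorm (@lebesgue_measure R) +oo%E (EFin \o (f \_ `[0, 1]))).

Definition l2norm (R : realType) (n : nat) (x : 'cV[R[i]]_n) : R :=
  Num.sqrt (\sum_i Normc.normc (x i 0) ^+ 2).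

Definition opnorm (R : realType) (n : nat) (A : 'M[R[i]]_n) : R :=
  sup [set l2norm (A *m x) | x in [set x | l2norm x <= 1]].

Definition mx22 (T : Type) (a b c d : T) : 'M[T]_2 :=
  \matrix_(i < 2, j < 2)
    if i == 0 then (if j == 0 then a else b) else (if j == 0 then c else d).

(* Where a (x + omega) = 0, a null set of x, the value is the zero matrix,
   since 0^-1 = 0. *)
Definition jacobi_mx (R : realType) (la : R) (a : R -> R[i])
    (lv : R) (v : R -> R) (x E omega : R) : 'M[R[i]]_2 :=
  (la%:C * a (x + omega))^-1 *:
    mx22 (lv * v x - E)%:C       (- (la%:C * conjc (a x)))
         (la%:C * a (x + omega)) 0.

(* M(x + n omega) * ... * M(x + 2 omega) * M(x + omega) *)
Definition jacobi_transfer (R : realType) (la : R) (a : R -> R[i])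
    (lv : R) (v : R -> R) (n : nat) (x E omega : R) : 'M[R[i]]_2 :=
  \prod_(k <- rev (iota 1 n)) jacobi_mx la a lv v (x + k%:R * omega) E omega.

Definition lyapunov (R : realType) (la : R) (a : R -> R[i])
    (lv : R) (v : R -> R) (E omega : R) : \bar R :=
  limn (fun n : nat => (n%:R^-1)%:E *
    \int[@lebesgue_measure R]_(x in `[0%R, 1%R])
      (ln (opnorm (jacobi_transfer la a lv v n x E omega)))%:E)%E.

Definition energy_interval (R : realType) (la : R) (a : R -> R[i])
    (lv : R) (v : R -> R) : set R :=
  let b := 2 * la * Linfty_circle (fun x => Normc.normc (a x))
           + lv * Linfty_circle (fun x => `|v x|) in
  `[- b, b].

(* Main.v *)
Require Import Defs.
From HB Require Import structures.
From mathcomp Require Import all_boot all_order all_algebra.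
From mathcomp Require Import complex.
From mathcomp Require Import all_classical all_reals all_analysis.
From mathcomp Require Import measurable_realfun cyclic separable cyclotomic ring lra zify.
Set Implicit Arguments.
Unset Strict Implicit.
Unset Printing Implicit Defensive.
Import Order.TTheory GRing.Theory Num.Theory numFieldNormedType.Exports.
Local Open Scope classical_set_scope.
Local Open Scope ring_scope.
Local Open Scope complex_scope.
Local Notation cabs := (@Normc.normc _).
Local Notation Re := (@complex.Re _).
Local Notation Im := (@complex.Im _).

(** Why a large coupling forces a large exponent.  The functions v, a and the
conjugate of a extend to periodic functions V, A and Ac that are holomorphic
on a strip around the real axis.  Without its scalar denominators the cocycle
is a product of matrices with entries in these functions, and the top left
entry p_n of the n-step product extends to the strip too.  On the whole strip
|p_n| is at most (C lv) ^ n.  On a horizontal line Im z = y on which V stays at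
distance at least d from E / lv, the diagonal term lv V - E dominates, the
cocycle is uniformly hyperbolic and |p_n| is at least (lv d / 2) ^ n.  Such
lines exist because the zeros of a nonzero holomorphic function are isolated,
and d can be chosen uniformly in E because V is not constant and E / lv stays
in a compact interval (strip_value_free_lines).

The lower bound has to be brought down from the line Im z = y to the real axis,
where the exponent lives.  The mean of log |F| over horizontal lines is convex
in the height, so its value at height 0 is at least twice the value at height
y minus the value at height 2 y (mean_ln_max_lower_bound).  This is derived
from the maximum principle alone: n times the mean of log |F| is close to the
sum of the log |F(x + j / n)| over j < n, that is to the logarithm of the modulus
of one holomorphic function.  With F = p_n this shows that the integral of log |p_n| is at least
n (2 log (lv d / 2) - log (C lv)) = n (log lv - C').

The same inequality, at a fixed function, shows that log |F| is integrable on
the circle and that F has almost no real zeros (ln_cabs_integrable).  Applied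
to a, it makes the denominators harmless: they contribute the finite constant
given by the mean of log |la a| to the exponent.  Applied to p_n, it makes
the logarithm of the norm of the product integrable and, almost everywhere,
subadditive, so Fekete's lemma gives the existence of the limit
(lyapunov_lower_bound).  In total the exponent is at least log lv - C'' with C''
independent of lv, E and omega, which exceeds (1 - gamma) log lv as soon as
gamma log lv > C''.

The complex analysis is developed from uniform limits of polynomials on closed
discs, whose theory only needs sums over roots of unity.  The identity theorem
follows from Schwarz's lemma applied to many zeros (poly_le_of_small_nodes). *)

(** * The modulus of a complex number *)

Section Modulus.
Context {R : realType}.
Implicit Types (x y z w : R[i]) (r : R).

Lemma cabs_ge0 z : 0 <= cabs z.
Proof. by case: z => a b; exact: sqrtr_ge0. Qed.

Lemma cabsD x y : cabs (x + y) <= cabs x + cabs y.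
Proof. exact: le_normcD. Qed.

Lemma cabsN x : cabs (- x) = cabs x.
Proof. exact: normcN. Qed.

Lemma cabsC x y : cabs (x - y) = cabs (y - x).
Proof. by rewrite -cabsN opprB. Qed.

Lemma cabsB_trans y x z : cabs (x - z) <= cabs (x - y) + cabs (y - z).
Proof. by rewrite (le_trans _ (cabsD _ _))// addrA subrK. Qed.

Lemma cabs_real r : cabs (r%:C) = `|r|.
Proof. by rewrite /= expr0n /= addr0 sqrtr_sqr. Qed.

Lemma cabs_real_ge0 r : 0 <= r -> cabs (r%:C) = r.
Proof. by move=> r0; rewrite cabs_real ger0_norm. Qed.

Lemma cabs_nat n : cabs (n%:R : R[i]) = n%:R.
Proof.
by rewrite -(rmorph_nat (real_complex R)) cabs_real_ge0 ?ler0n.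
Qed.

Lemma cabs_eq0 z : (cabs z == 0) = (z == 0).
Proof.
by apply/eqP/eqP => [/Normc.eq0_normc//|->]; exact: Normc.normc0.
Qed.

Lemma cabs_gt0 z : (0 < cabs z) = (z != 0).
Proof. by rewrite lt_neqAle cabs_ge0 andbT eq_sym cabs_eq0. Qed.

Lemma cabsX z n : cabs (z ^+ n) = cabs z ^+ n.
Proof.
elim: n => [|n IH]; first by rewrite !expr0 Normc.normc1.
by rewrite !exprS Normc.normcM IH.
Qed.

Lemma cabs_prod I (s : seq I) (F : I -> R[i]) :
  cabs (\prod_(i <- s) F i) = \prod_(i <- s) cabs (F i).
Proof.
elim: s => [|i s IH]; first by rewrite !big_nil Normc.normc1.
by rewrite !big_cons Normc.normcM IH.
Qed.

Lemma cabs_sum I (s : seq I) (F : I -> R[i]) :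
  cabs (\sum_(i <- s) F i) <= \sum_(i <- s) cabs (F i).
Proof.
elim: s => [|i s IH]; first by rewrite !big_nil Normc.normc0.
by rewrite !big_cons (le_trans (cabsD _ _))// lerD2l.
Qed.

Lemma cabs_lerB_dist x y : `|cabs x - cabs y| <= cabs (x - y).
Proof.
rewrite ler_norml lerBDl lerBlDr addrC.
have := cabsD (x - y) y; have := cabsD (y - x) x.
rewrite !subrK (cabsC y x) => h1 h2.
by apply/andP; split => //; lra.
Qed.

Lemma normr_Im_le z : `|Im z| <= cabs z.
Proof.
case: z => a b /=; rewrite -sqrtr_sqr ler_sqrt ?addr_ge0 ?sqr_ge0//.
by rewrite lerDr sqr_ge0.
Qed.

Lemma normr_Re_le z : `|Re z| <= cabs z.
Proof.
case: z => a b /=; rewrite -sqrtr_sqr ler_sqrt ?addr_ge0 ?sqr_ge0//.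
by rewrite lerDl sqr_ge0.
Qed.

Lemma cabs_le_ReIm z : cabs z <= `|Re z| + `|Im z|.
Proof.
have {1}-> : z = (Re z)%:C + 'i%C * (Im z)%:C by case: z => a b; simpc.
rewrite (le_trans (cabsD _ _))// Normc.normcM !cabs_real lerD2l.
by rewrite /= expr0n /= expr1n add0r sqrtr1 mul1r.
Qed.

Lemma cabs_conj z : cabs (z^*)%C = cabs z.
Proof. by case: z => a b /=; rewrite sqrrN. Qed.

Lemma complex_normE z : `|z| = (cabs z)%:C.
Proof. by case: z => a b; rewrite normc_def. Qed.

Lemma Im_add_real z r : Im (z + r%:C) = Im z.
Proof. by case: z => a b /=; rewrite addr0. Qed.

End Modulus.

(** Lebesgue's number lemma for a property of intervals, given by a radius and
a centre, that passes to subintervals. *)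
Lemma segment_uniform_scale (R : realType) (P : R -> R -> Prop) (a b : R) :
  (forall r x r' x' : R, P r x -> `|x' - x| + r' <= r -> P r' x') ->
  (forall x : R, a <= x <= b -> exists2 r : R, 0 < r & P r x) ->
  exists2 r : R, 0 < r & forall x : R, a <= x <= b -> P r x.
Proof.
move=> Pmono Ploc.
have /compact_near_coveringP cov := @segment_compact R a b.
have := cov _ (0^'+) (fun r x => P r x) _; case.
  move=> x; rewrite /= in_itv /= => /Ploc[r r0 Prx].
  near=> x' r' => /=; apply: (Pmono _ _ _ _ Prx).
  have : ball x (r / 2) x'.
    by near: x'; apply: nbhsx_ballx; rewrite divr_gt0.
  rewrite -ball_normE /=.
  have : r' < r / 2.
    by near: r'; apply: nbhs_right_lt; rewrite divr_gt0.
  by rewrite distrC; lra.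
move=> e /= e0 He; exists (e / 2); first by rewrite divr_gt0.
move=> x xab; apply: (He (e / 2)) => //=.
- by rewrite sub0r normrN ger0_norm; lra.
- by rewrite divr_gt0.
Unshelve. all: by end_near. Qed.

(** * Polynomials on circles, by sums over roots of unity *)

Section RootsOfUnity.
Context {R : realType}.
Local Notation C := R[i].

Lemma complex_prim_root (n : nat) : (0 < n)%N ->
  exists z : C, n.-primitive_root z.
Proof.
move=> n_gt0; pose p : {poly C} := 'X^n - 1.
have [r Dp] := closed_field_poly_normal p.
rewrite (monicP _) ?monicXnsubC // scale1r in Dp.
have rn1 : all n.-unity_root r by apply/allP=> z; rewrite -root_prod_XsubC -Dp.
have sz_r : (n < (size r).+1)%N.
  by rewrite -(size_prod_XsubC r id) -Dp size_XnsubC.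
have [|z _ ?] := hasP (has_prim_root n_gt0 rn1 _ sz_r); last by exists z.
rewrite -separable_prod_XsubC -Dp.
by rewrite separable_Xn_sub_1 // pnatr_eq0 -lt0n.
Qed.

Lemma cabs_prim_root n (z : C) : n.-primitive_root z -> cabs z = 1.
Proof.
move=> zn; have n0 := prim_order_gt0 zn.
have /(congr1 (fun x => cabs x)) := prim_expr_order zn.
rewrite cabsX Normc.normc1 => /eqP.
by rewrite pexprn_eq1 ?cabs_ge0// gtn_eqF//= => /eqP.
Qed.

Lemma prim_root_sum n (z : C) m : n.-primitive_root z ->
  \sum_(j < n) (z ^+ m) ^+ j = if (n %| m)%N then n%:R else 0.
Proof.
move=> zn; rewrite (prim_order_dvd zn); case: eqP => [->|/eqP zm].
  by under eq_bigr do rewrite expr1n; rewrite sumr_const card_ord.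
have := subrX1 (z ^+ m) n.
rewrite -exprM mulnC exprM (prim_expr_order zn) expr1n subrr => /esym/eqP.
by rewrite mulf_eq0 subr_eq0 (negbTE zm)/= => /eqP.
Qed.

(** Discrete Fourier inversion: the coefficients of a polynomial are recovered
from its values at the roots of unity. *)
Lemma prim_root_coef n (z : C) (Q : {poly C}) (k : nat) :
    n.-primitive_root z -> (size Q <= n)%N -> (k < n)%N ->
  \sum_(j < n) Q.[z ^+ j] * (z ^+ j) ^+ (n - k) = n%:R * Q`_k.
Proof.
move=> zn sQ kn.
transitivity (\sum_(j < n) \sum_(i < n) Q`_i * (z ^+ (i + (n - k))) ^+ j).
  apply: eq_bigr => j _; rewrite (horner_coef_wide _ sQ) big_distrl /=.
  apply: eq_bigr => i _; rewrite -mulrA -exprD.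
  by rewrite -!exprM mulnC.
rewrite exchange_big /= (bigD1 (Ordinal kn)) //= -big_distrr /=.
rewrite prim_root_sum// subnKC ?(ltnW kn)// dvdnn mulrC big1 ?addr0// => i ik.
rewrite -big_distrr /= prim_root_sum//; case: ifP => [|_]; last by rewrite mulr0.
move=> /dvdnP[q qE]; case/negP: ik; apply/eqP/val_inj => /=.
have := ltn_ord i; move: qE; case: q => [|[|q]]; nia.
Qed.

(** The mean value property.  The equidistant points of a circle compute it
exactly once they outnumber the degree, which replaces integration. *)
Lemma prim_root_mean n (z : C) (P : {poly C}) (c s : C) :
    n.-primitive_root z -> (size P <= n)%N ->
  \sum_(j < n) P.[c + s * z ^+ j] = n%:R * P.[c].
Proof.
move=> zn sP; have n0 := prim_order_gt0 zn.
pose Q := P \Po (c%:P + s *: 'X).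
have sQ : (size Q <= n)%N.
  apply: leq_trans sP; case: (P =P 0) => [P0|/eqP P0].
    by rewrite /Q P0 comp_poly0 size_poly0.
  rewrite -(prednK (n := size P)) ?size_poly_gt0//.
  apply: (leq_trans (size_comp_poly_leq _ _)); rewrite ltnS.
  rewrite -{2}(muln1 (size P).-1) leq_mul2l; apply/orP; right.
  have : (size (c%:P + s *: 'X)%R <= 2)%N.
    rewrite (leq_trans (size_polyD _ _))// geq_max.
    rewrite (leq_trans (size_polyC_leq1 _))//=.
    by rewrite (leq_trans (size_scale_leq _ _))// size_polyX.
  by case: (size _) => [|[|]].
have QE w : Q.[w] = P.[c + s * w] by rewrite horner_comp !hornerE.
have := prim_root_coef zn sQ n0; rewrite subn0 -horner_coef0 QE mulr0 addr0.
move=> <-; apply: eq_bigr => j _.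
by rewrite exprAC (prim_expr_order zn) expr1n mulr1 QE.
Qed.

Lemma poly_coef_le_circle (Q : {poly C}) (B : R) (k : nat) :
  (forall w : C, cabs w = 1 -> cabs Q.[w] <= B) -> cabs Q`_k <= B.
Proof.
move=> QB; pose n := (maxn (size Q) k).+1.
have [z zn] := @complex_prim_root n isT.
have z1 := cabs_prim_root zn.
have sQ : (size Q <= n)%N by rewrite leqW// leq_maxl.
have kn : (k < n)%N by rewrite ltnS leq_maxr.
have E := prim_root_coef zn sQ kn.
have : cabs (n%:R * Q`_k) <= n%:R * B.
  rewrite -E (le_trans (cabs_sum _ _))//.
  have -> : n%:R * B = \sum_(j < n) B by rewrite sumr_const card_ord mulr_natl.
  apply: ler_sum => j _.
  by rewrite Normc.normcM !cabsX z1 !expr1n mulr1 QB// cabsX z1 expr1n.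
by rewrite Normc.normcM cabs_nat ler_pM2l// ltr0n.
Qed.

(** A crude maximum principle: Cauchy's bounds for the coefficients, summed as
a geometric series. *)
Lemma poly_le_half_disc (P : {poly C}) (c : C) (r B : R) : 0 < r ->
  (forall z : C, cabs (z - c) = r -> cabs P.[z] <= B) ->
  forall z : C, cabs (z - c) <= r / 2 -> cabs P.[z] <= 2 * B.
Proof.
move=> r0 PB z zc.
pose Q := P \Po (c%:P + r%:C *: 'X).
have rC0 : r%:C != 0 by rewrite -cabs_eq0 cabs_real_ge0 ?(ltW r0)// gt_eqF.
have QE w : Q.[w] = P.[c + r%:C * w] by rewrite horner_comp !hornerE.
have Qk k : cabs Q`_k <= B.
  apply: poly_coef_le_circle => w w1; rewrite QE PB// addrC addKr.
  by rewrite Normc.normcM w1 cabs_real_ge0 ?(ltW r0)// mulr1.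
have B0 : 0 <= B by rewrite (le_trans (cabs_ge0 _) (Qk 0%N)).
pose w := (z - c) / r%:C.
have -> : P.[z] = Q.[w] by rewrite QE mulrC divfK// addrC subrK.
have w2 : cabs w <= 2^-1.
  rewrite Normc.normcM Normc.normcV cabs_real_ge0 ?(ltW r0)//.
  by rewrite ler_pdivrMr// mulrC.
rewrite horner_coef (le_trans (cabs_sum _ _))//.
have le1 : \sum_(i < size Q) cabs (Q`_i * w ^+ i) <=
           \sum_(i < size Q) B * 2^-1 ^+ i.
  apply: ler_sum => i _; rewrite Normc.normcM cabsX ler_pM ?cabs_ge0//.
    by rewrite exprn_ge0// cabs_ge0.
  by rewrite lerXn2r ?nnegrE ?cabs_ge0// invr_ge0.
rewrite (le_trans le1)// -mulr_sumr mulrC ler_wpM2r//.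
have := subrX1 (2^-1 : R) (size Q).
have : 0 <= (2^-1 : R) ^+ size Q by rewrite exprn_ge0// invr_ge0.
by move: (_ ^+ _) (\sum_(_ < _) _) => a b a0 E; lra.
Qed.

Lemma poly_bounded (P : {poly C}) (r : R) :
  exists2 B, 0 < B & forall z : C, cabs z <= r -> cabs P.[z] <= B.
Proof.
exists (1 + \sum_(i < size P) cabs P`_i * Num.max r 0 ^+ i).
  rewrite ltr_pwDl// sumr_ge0// => i _.
  by rewrite mulr_ge0 ?cabs_ge0// exprn_ge0// le_max lexx orbT.
move=> z zr; rewrite horner_coef (le_trans (cabs_sum _ _))//.
rewrite -[leLHS]add0r lerD// ler_sum// => i _.
rewrite Normc.normcM cabsX ler_wpM2l ?cabs_ge0//.
by rewrite lerXn2r ?nnegrE ?cabs_ge0 ?le_max ?zr// lexx orbT.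
Qed.

Lemma poly_continuous (P : {poly C}) (z0 : C) (e : R) : 0 < e ->
  exists2 d, 0 < d & forall z : C, cabs (z - z0) < d -> cabs (P.[z] - P.[z0]) < e.
Proof.
move=> e0; have : root (P - P.[z0]%:P) z0 by rewrite rootE !hornerE subrr.
case/factor_theorem => Q PQ.
have [B B0 QB] := poly_bounded Q (cabs z0 + 1).
exists (Num.min 1 (e / B)); first by rewrite lt_min ltr01 divr_gt0.
move=> z; rewrite lt_min => /andP[z1 ze].
have -> : P.[z] - P.[z0] = Q.[z] * (z - z0).
  by have := congr1 (fun p => p.[z]) PQ; rewrite !hornerE.
rewrite Normc.normcM mulrC.
have [->|zz] := eqVneq z z0; first by rewrite subrr Normc.normc0 mul0r.
rewrite (le_lt_trans (ler_wpM2l (cabs_ge0 _) (QB _ _)))//.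
  by rewrite -[z](subrK z0) (le_trans (cabsD _ _))// addrC lerD2l ltW.
by rewrite -ltr_pdivlMr.
Qed.

End RootsOfUnity.

(** * The disc algebra and its identity theorem *)

Section DiscAlgebra.
Context {R : realType}.
Local Notation C := R[i].

(** Schwarz's lemma for many zeros: dividing out one zero in the quarter disc
costs the factor (r / 2) / (3 r / 4) = 2 / 3.  The zeros are only approximate,
so that the lemma passes to uniform limits of polynomials. *)
Lemma poly_le_of_small_nodes (c : C) (r : R) (s : seq C) :
    0 < r -> uniq s -> (forall x : C, x \in s -> cabs (x - c) <= r / 4) ->
  forall B eta : R, 0 <= B -> 0 < eta -> exists2 e : R, 0 < e &
  forall P : {poly C},
    (forall z : C, cabs (z - c) = r -> cabs P.[z] <= B) ->
    (forall x : C, x \in s -> cabs P.[x] <= e) ->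
  forall z : C, cabs (z - c) <= r / 4 ->
    cabs P.[z] <= 2 * B * (2 / 3) ^+ size s + eta.
Proof.
move=> r0; elim: s => [_ _|x s IH /= /andP[xs us] sc] B eta B0 eta0.
  exists 1 => // P PB _ z zc; rewrite expr0 mulr1.
  rewrite (le_trans (poly_le_half_disc r0 PB _))//; last by rewrite lerDl ltW.
  by rewrite (le_trans zc)// ler_pM2l// lef_pV2 ?posrE// ler_nat.
have xc : cabs (x - c) <= r / 4 by rewrite sc// mem_head.
have {}IH := IH us (fun y ys => sc y (mem_behead (s := x :: s) ys)).
have [d d0 ds] : exists2 d : R, 0 < d & forall y : C, y \in s -> d <= cabs (y - x).
  elim: s xs {us sc IH} => [_|y s IHs]; first by exists 1.
  rewrite inE negb_or => /andP[xy /IHs[d d0 ds]].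
  exists (Num.min d (cabs (y - x))).
    by rewrite lt_min d0 cabs_gt0 subr_eq0 eq_sym.
  move=> w; rewrite inE => /orP[/eqP->|/ds dw]; rewrite ge_min ?lexx ?orbT//.
  by rewrite dw.
(* Dividing by y - x at another node y costs at most a factor 1 / d, which
   fixes the precision required of P at the nodes. *)
pose e0 := eta / 6; have e00 : 0 < e0 by rewrite divr_gt0.
pose B' := (B + e0) * (4 / (3 * r)).
have B'0 : 0 <= B'.
  by rewrite mulr_ge0 ?addr_ge0 ?(ltW e00)// divr_ge0// mulr_ge0// ltW.
have [|e1 e10 IHe] := IH B' (eta / 3 * (2 / r)) B'0.
  by rewrite mulr_gt0 ?divr_gt0.
exists (Num.min (Num.min (eta / 3) e0) (e1 * d / 2)).
  by rewrite !lt_min !divr_gt0// mulr_gt0.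
move=> P PB Ps z zc.
have Px : cabs P.[x] <= Num.min (Num.min (eta / 3) e0) (e1 * d / 2).
  by rewrite Ps// mem_head.
have /factor_theorem[Q PQ] : root (P - P.[x]%:P) x by rewrite rootE !hornerE subrr.
have QE y : P.[y] - P.[x] = Q.[y] * (y - x).
  by have := congr1 (fun p => p.[y]) PQ; rewrite !hornerE.
have nQE y : cabs Q.[y] * cabs (y - x) <= cabs P.[y] + cabs P.[x].
  by rewrite -Normc.normcM -QE (le_trans (cabsD _ _))// cabsN.
(* The node x is at distance at least 3 r / 4 from the circle. *)
have QB y : cabs (y - c) = r -> cabs Q.[y] <= B'.
  move=> yc; have yx : 3 * r / 4 <= cabs (y - x).
    by have := cabsB_trans x y c; rewrite yc; lra.
  rewrite /B' mulrA ler_pdivlMr ?mulr_gt0//.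
  have := nQE y; have := PB _ yc; move: Px; rewrite !le_min -andbA.
  move=> /and3P[_ Pxe _] Py.
  have : cabs Q.[y] * (3 * r / 4) <= cabs Q.[y] * cabs (y - x).
    by rewrite ler_wpM2l ?cabs_ge0.
  lra.
have Qs y : y \in s -> cabs Q.[y] <= e1.
  move=> ys; have dy := ds _ ys; have := nQE y.
  have : cabs P.[y] <= e1 * d / 2.
    have : y \in x :: s by rewrite inE ys orbT.
    by move=> /Ps; rewrite le_min => /andP[].
  move: Px; rewrite le_min => /andP[_ Px] Py nQ.
  rewrite -(ler_pM2r d0).
  have : cabs Q.[y] * d <= cabs Q.[y] * cabs (y - x).
    by rewrite ler_wpM2l ?cabs_ge0.
  lra.
have := IHe Q QB Qs z zc; set q := (2 / 3) ^+ size s => Qz.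
have zx : cabs (z - x) <= r / 2.
  by have := cabsB_trans c z x; rewrite (cabsC c x); lra.
have q0 : 0 <= q by rewrite exprn_ge0// divr_ge0.
have q1 : q <= 1 by rewrite exprn_ile1//; lra.
rewrite exprS -/q.
have -> : P.[z] = P.[x] + Q.[z] * (z - x) by rewrite -QE addrC subrK.
rewrite (le_trans (cabsD _ _))// Normc.normcM.
have : cabs Q.[z] * cabs (z - x) <= (2 * B' * q + eta / 3 * (2 / r)) * (r / 2).
  by rewrite ler_pM ?cabs_ge0.
have -> : (2 * B' * q + eta / 3 * (2 / r)) * (r / 2) =
          4 / 3 * (B + e0) * q + eta / 3.
  by rewrite /B'; field; rewrite gt_eqF.
move: Px; rewrite !le_min -andbA => /and3P[Px _ _].
have : e0 * q <= e0 by rewrite ler_piMr// ltW.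
rewrite /e0; lra.
Qed.

(** The disc algebra of the closed disc of centre c and radius r: the uniform
limits of polynomials.  It serves as a substitute for holomorphy that is stable
under the operations needed and inherits estimates from polynomials. *)
Definition disc_algebra (c : C) (r : R) (H : C -> C) : Prop :=
  forall e : R, 0 < e -> exists P : {poly C},
    forall z : C, cabs (z - c) <= r -> cabs (H z - P.[z]) <= e.

Lemma disc_algebra_bounded c r H : disc_algebra c r H ->
  exists2 B : R, 0 < B & forall z, cabs (z - c) <= r -> cabs (H z) <= B.
Proof.
move=> /(_ 1 ltr01)[P HP].
have [B B0 PB] := poly_bounded P (cabs c + r).
exists (1 + B); first by rewrite addr_gt0.
move=> z zc; rewrite -[H z](subrK P.[z]) (le_trans (cabsD _ _))// lerD ?HP//.
by apply: PB; rewrite -[z](subrK c) (le_trans (cabsD _ _))// addrC lerD2l.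
Qed.

Lemma disc_algebra_poly c r (P : {poly C}) : disc_algebra c r (horner P).
Proof.
by move=> e e0; exists P => z _; rewrite subrr Normc.normc0 ltW.
Qed.

Lemma disc_algebra_ext c r H1 H2 :
  (forall z, cabs (z - c) <= r -> H1 z = H2 z) ->
  disc_algebra c r H1 -> disc_algebra c r H2.
Proof. by move=> E h e /h[P HP]; exists P => z zc; rewrite -E ?HP. Qed.

Lemma disc_algebra_cst c r (a : C) : disc_algebra c r (fun=> a).
Proof.
apply: disc_algebra_ext (disc_algebra_poly c r a%:P) => z _.
by rewrite hornerC.
Qed.

Lemma disc_algebraD c r H1 H2 : disc_algebra c r H1 -> disc_algebra c r H2 ->
  disc_algebra c r (fun z => H1 z + H2 z).
Proof.
move=> h1 h2 e e0; have e2 : 0 < e / 2 by rewrite divr_gt0.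
have [P1 HP1] := h1 _ e2; have [P2 HP2] := h2 _ e2.
exists (P1 + P2) => z zc; rewrite hornerD opprD addrACA.
by rewrite (le_trans (cabsD _ _))// [e]splitr lerD ?HP1 ?HP2.
Qed.

Lemma disc_algebraM c r H1 H2 : disc_algebra c r H1 -> disc_algebra c r H2 ->
  disc_algebra c r (fun z => H1 z * H2 z).
Proof.
move=> h1 h2 e e0.
have [B1 B10 HB1] := disc_algebra_bounded h1.
have [B2 B20 HB2] := disc_algebra_bounded h2.
pose d := Num.min 1 (e / (B1 + B2 + 1)).
have B0 : 0 < B1 + B2 + 1 by rewrite !addr_gt0.
have d0 : 0 < d by rewrite lt_min ltr01 divr_gt0.
have d1 : d <= 1 by rewrite ge_min lexx.
have dB : d * (B1 + B2 + 1) <= e by rewrite -ler_pdivlMr// ge_min lexx orbT.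
have [P1 HP1] := h1 _ d0; have [P2 HP2] := h2 _ d0.
exists (P1 * P2) => z zc; rewrite hornerM.
have {HP1} HP1 := HP1 z zc; have {HP2} HP2 := HP2 z zc.
have {HB1} HB1 := HB1 z zc; have {HB2} HB2 := HB2 z zc.
have -> : H1 z * H2 z - P1.[z] * P2.[z] =
  (H1 z - P1.[z]) * H2 z + H1 z * (H2 z - P2.[z])
  + - ((H1 z - P1.[z]) * (H2 z - P2.[z])) by ring.
apply: (le_trans (cabsD _ _)); rewrite cabsN.
apply: (le_trans (lerD (cabsD _ _) (lexx _))); rewrite !Normc.normcM.
apply: le_trans dB; rewrite !mulrDr mulr1 (mulrC d B1) (addrC (B1 * d)).
rewrite lerD ?lerD ?ler_pM ?cabs_ge0//.
by rewrite -[d]mulr1 ler_pM ?cabs_ge0// (le_trans HP2).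
Qed.

Lemma disc_algebraN c r H : disc_algebra c r H ->
  disc_algebra c r (fun z => - H z).
Proof.
move=> /(disc_algebraM (disc_algebra_cst c r (-1))).
by apply: disc_algebra_ext => z _; rewrite mulN1r.
Qed.

Lemma disc_algebra_prod c r I (s : seq I) (H : I -> C -> C) :
  (forall i, disc_algebra c r (H i)) ->
  disc_algebra c r (fun z => \prod_(i <- s) H i z).
Proof.
move=> h; elim: s => [|i s IH].
  apply: disc_algebra_ext (disc_algebra_cst c r 1) => z _.
  by rewrite big_nil.
apply: disc_algebra_ext (disc_algebraM (h i) IH) => z _.
by rewrite big_cons.
Qed.

Lemma disc_algebraS c c' r r' H : cabs (c' - c) + r' <= r ->
  disc_algebra c r H -> disc_algebra c' r' H.
Proof.
move=> cr h e /h[P HP]; exists P => z zc; apply: HP.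
by rewrite (le_trans (cabsB_trans c' z c))// addrC (le_trans _ cr)// lerD2l.
Qed.

Lemma disc_algebra_affine c r a b H : cabs a = 1 ->
  disc_algebra (a * c + b) r H -> disc_algebra c r (fun z => H (a * z + b)).
Proof.
move=> a1 h e /h[P HP]; exists (P \Po (a *: 'X + b%:P)) => z zc.
rewrite horner_comp !hornerE; apply: HP.
by rewrite opprD addrACA subrr addr0 -mulrBr Normc.normcM a1 mul1r.
Qed.

Lemma disc_algebra_shift c r b H :
  disc_algebra (c + b) r H -> disc_algebra c r (fun z => H (z + b)).
Proof.
move=> h; have := @disc_algebra_affine c r 1 b H; rewrite mul1r Normc.normc1.
move=> /(_ erefl h); apply: disc_algebra_ext => z _.
by rewrite mul1r.
Qed.

Lemma disc_algebra_continuous c r H z0 e : disc_algebra c r H ->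
    cabs (z0 - c) <= r -> 0 < e -> exists2 d : R, 0 < d &
  forall z, cabs (z - c) <= r -> cabs (z - z0) < d -> cabs (H z - H z0) < e.
Proof.
move=> h z0c e0; have e3 : 0 < e / 3 by rewrite divr_gt0.
have [P HP] := h _ e3; have [d d0 Pd] := poly_continuous P z0 e3.
exists d => // z zc zd.
have := HP _ zc; have := HP _ z0c; have := Pd _ zd.
rewrite (cabsC (H z0)).
have := cabsB_trans P.[z] (H z) (H z0).
have := cabsB_trans P.[z0] P.[z] (H z0).
lra.
Qed.

(** Identity theorem: iterating the Schwarz factor 2 / 3 over arbitrarily many
zeros leaves only the zero function. *)
Lemma disc_algebra_eq0 c r H : 0 < r -> disc_algebra c r H ->
    (forall k : nat, exists2 s : seq C, uniq s /\ size s = k &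
      forall x, x \in s -> cabs (x - c) <= r / 4 /\ H x = 0) ->
  forall z, cabs (z - c) <= r / 4 -> H z = 0.
Proof.
move=> r0 h zeros z zc; apply/eqP; rewrite -cabs_eq0 eq_le cabs_ge0 andbT.
have [B B0 HB] := disc_algebra_bounded h.
have zr : cabs (z - c) <= r by rewrite (le_trans zc)//; lra.
have key (k : nat) (eta : R) : 0 < eta ->
    cabs (H z) <= 2 * (B + 1) * (2 / 3) ^+ k + eta.
  move=> eta0; have [s [us sk] Hs] := zeros k.
  have sc x : x \in s -> cabs (x - c) <= r / 4 by case/Hs.
  have e20 : 0 < eta / 2 by rewrite divr_gt0.
  have B10 : 0 <= B + 1 by rewrite addr_ge0// ltW.
  have [e e0 Pe] := poly_le_of_small_nodes r0 us sc B10 e20.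
  pose e' := Num.min (Num.min e 1) (eta / 2).
  have e'0 : 0 < e' by rewrite !lt_min e0 e20 ltr01.
  have [P HP] := h _ e'0.
  have PB x : cabs (x - c) = r -> cabs P.[x] <= B + 1.
    move=> xc; have xr : cabs (x - c) <= r by rewrite xc.
    have := HP _ xr; have := HB _ xr; rewrite !le_min -andbA cabsC.
    have := cabsD (P.[x] - H x) (H x); rewrite subrK => ? ? /and3P[? ? ?].
    lra.
  have Ps x : x \in s -> cabs P.[x] <= e.
    move=> xs; have [xc Hx] := Hs _ xs.
    have := HP x; rewrite Hx sub0r cabsN !le_min -andbA.
    by case/(_ _)/and3P => //; rewrite (le_trans xc)//; lra.
  have := Pe P PB Ps z zc; rewrite sk.
  have := HP z zr; rewrite !le_min -andbA => /and3P[_ _].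
  have := cabsD (H z - P.[z]) P.[z]; rewrite subrK.
  lra.
apply/ler_addgt0Pl => e e0.
have lim0 : (2 / 3 : R) ^+ n @[n --> \oo] --> (0 : R).
  by apply: cvg_expr; rewrite ger0_norm; lra.
have : \forall n \near \oo, (2 / 3 : R) ^+ n < e / 2 / (2 * (B + 1)).
  have := @cvgr_lt R nat \oo _ _ _ lim0; apply.
  by rewrite !divr_gt0// mulr_gt0// addr_gt0.
case=> n _ /(_ n (leqnn n)); rewrite ltr_pdivlMr ?mulr_gt0 ?addr_gt0// => hn.
have e2 : 0 < e / 2 by rewrite divr_gt0.
have := key n _ e2; lra.
Qed.

End DiscAlgebra.

(** * Complex extension of a power series *)

Section Extension.
Context {R : realType}.
Local Notation C := R[i].

Lemma cvg_seq_dist (K : numFieldType) (u : nat -> K) (l : K) : u @ \oo --> l ->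
  forall e : K, 0 < e -> exists N, forall n, (N <= n)%N -> `|u n - l| < e.
Proof.
move=> ul e e0; have /cvgrPdist_lt/(_ _ e0)[N _ HN] := ul.
by exists N => n /HN /=; rewrite distrC.
Qed.

Lemma cauchy_real_limit (u b : nat -> R) : b n @[n --> \oo] --> (0 : R) ->
  (forall n m, (n <= m)%N -> `|u m - u n| <= b n) ->
  exists l, forall n, `|u n - l| <= b n.
Proof.
move=> b0 ub.
have /cauchy_cvgP/cvg_ex[l ul] : cauchy (u n @[n --> \oo]).
  apply/cauchy_exP => e e0.
  have /cvgrPdist_lt/(_ _ e0)[N _ HN] := b0.
  exists (u N); exists N => // m /= Nm.
  have /= := HN N (leqnn N); rewrite sub0r normrN => bN.
  rewrite /ball /= distrC (le_lt_trans (ub _ _ Nm))//.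
  exact: le_lt_trans (ler_norm _) bN.
exists l => n; apply/ler_addgt0Pl => e e0.
have /cvgrPdist_lt/(_ _ e0)[N _ HN] := ul.
have /= := HN (maxn N n) (leq_maxl _ _); have := ub n (maxn N n) (leq_maxr _ _).
have := ler_distD (u (maxn N n)) (u n) l.
rewrite (distrC (u n) (u _)) (distrC l (u _)); lra.
Qed.

Lemma cauchy_complex_limit (u : nat -> C) (b : nat -> R) :
  b n @[n --> \oo] --> (0 : R) ->
  (forall n m, (n <= m)%N -> cabs (u m - u n) <= b n) ->
  exists l, forall n, cabs (u n - l) <= 2 * b n.
Proof.
move=> b0 ub.
have ReB (x y : C) : Re (x - y) = Re x - Re y by case: x; case: y.
have ImB (x y : C) : Im (x - y) = Im x - Im y by case: x; case: y.
have [|a ua] := @cauchy_real_limit (Re \o u) b b0.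
  by move=> n m nm /=; rewrite -ReB (le_trans (normr_Re_le _)) ?ub.
have [|c uc] := @cauchy_real_limit (Im \o u) b b0.
  by move=> n m nm /=; rewrite -ImB (le_trans (normr_Im_le _)) ?ub.
exists (a +i* c) => n; rewrite (le_trans (cabs_le_ReIm _))// ReB ImB /=.
have := ua n; have := uc n; rewrite /=; lra.
Qed.

(** Convergence at the real point x0 + r / 2 bounds c_k (r / 2) ^ k, so on the
complex disc of radius r / 4 the partial sums are dominated by a geometric
series and converge uniformly. *)
Lemma power_series_disc_algebra (f : R -> C) (x0 : R) (c : nat -> C) (r : R) :
    0 < r ->
    (forall x : R, `|x - x0| < r ->
      forall e : R, 0 < e -> exists N, forall n, (N <= n)%N ->
        cabs (\sum_(k < n) c k * (x - x0)%:C ^+ k - f x) < e) ->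
  exists2 rho : R, 0 < rho & exists2 H, disc_algebra x0%:C rho H &
    forall x : R, `|x - x0| <= rho -> H x%:C = f x.
Proof.
move=> r0 cf; pose s := r / 2; have s0 : 0 < s by rewrite divr_gt0.
have [B B0 cB] : exists2 B : R, 0 < B & forall k, cabs (c k) * s ^+ k <= B.
  have sr : `|x0 + s - x0| < r by rewrite addrC addKr ger0_norm ?ltW// /s; lra.
  have [N HN] := cf _ sr 1 ltr01.
  exists (2 + \sum_(k < N) cabs (c k) * s ^+ k).
    rewrite ltr_pwDl// sumr_ge0// => k _.
    by rewrite mulr_ge0 ?cabs_ge0// exprn_ge0// ltW.
  have pos k : 0 <= cabs (c k) * s ^+ k.
    by rewrite mulr_ge0 ?cabs_ge0// exprn_ge0// ltW.
  move=> k; case: (ltnP k N) => kN.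
    rewrite -[leLHS]add0r lerD// (bigD1 (Ordinal kN))//= lerDl.
    by rewrite sumr_ge0.
  rewrite -[leLHS]addr0 lerD ?sumr_ge0//.
  have := HN _ kN; have := HN _ (leqW kN); rewrite big_ord_recr /=.
  set S := \sum_(_ < k) _; rewrite [x0 + s]addrC addrK.
  set t := c k * _ => h1 h2.
  have -> : cabs (c k) * s ^+ k = cabs t.
    by rewrite Normc.normcM cabsX cabs_real_ge0// ltW.
  have -> : t = (S + t - f (s + x0)) - (S - f (s + x0)) by ring.
  by rewrite (le_trans (cabsD _ _))// cabsN; lra.
pose P n : {poly C} := \sum_(k < n) c k *: ('X - x0%:C%:P) ^+ k.
have PE n z : (P n).[z] = \sum_(k < n) c k * (z - x0%:C) ^+ k.
  rewrite horner_sum; apply: eq_bigr => k _.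
  by rewrite hornerZ horner_exp !hornerE.
pose rho := s / 2; have rho0 : 0 < rho by rewrite divr_gt0.
(* The tails are controlled by b, since b n - b n.+1 = B / 2 ^ n. *)
pose b n := 2 * B * (2^-1 : R) ^+ n.
have b0 : b n @[n --> \oo] --> (0 : R).
  rewrite -(mulr0 (2 * B)); apply: cvgMr.
  by apply: cvg_expr; rewrite ger0_norm ?invr_ge0// invf_lt1// ltr1n.
have Pcauchy z : cabs (z - x0%:C) <= rho -> forall n m, (n <= m)%N ->
    cabs ((P m).[z] - (P n).[z]) <= b n.
  move=> zr n m nm.
  suff : cabs ((P m).[z] - (P n).[z]) <= b n - b m.
    by move/le_trans; apply; rewrite gerBl !mulr_ge0// ?ltW// exprn_gt0 ?invr_gt0.
  elim: m nm => [|m IH]; first by rewrite leqn0 => /eqP->; rewrite !subrr Normc.normc0.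
  rewrite leq_eqVlt => /orP[/eqP->|]; first by rewrite !subrr Normc.normc0.
  rewrite ltnS => /IH h; rewrite [in (P m.+1).[z]]PE big_ord_recr /= -PE addrAC.
  rewrite (le_trans (cabsD _ _))//.
  have : cabs (c m * (z - x0%:C) ^+ m) <= B * 2^-1 ^+ m.
    have q0 : 0 <= (2^-1 : R) ^+ m by rewrite exprn_ge0// invr_ge0.
    rewrite Normc.normcM cabsX; apply: le_trans (ler_wpM2r q0 (cB m)).
    rewrite -mulrA ler_wpM2l ?cabs_ge0// -exprMn lerXn2r ?nnegrE ?cabs_ge0//.
    by rewrite mulr_ge0 ?invr_ge0// ltW.
  move: h; rewrite /b exprS; set q := 2^-1 ^+ m; lra.
have /choice[H HH] : forall z : C, exists l : C,
    cabs (z - x0%:C) <= rho -> forall n, cabs ((P n).[z] - l) <= 2 * b n.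
  move=> z; have [zr|zr] := leP (cabs (z - x0%:C)) rho.
    by have [l Hl] := cauchy_complex_limit b0 (Pcauchy z zr); exists l.
  by exists 0.
have b20 : 2 * b n @[n --> \oo] --> (0 : R).
  by rewrite -(mulr0 2); apply: cvgMr.
exists rho => //; exists H.
  move=> e e0; have /cvgrPdist_lt/(_ _ e0)[N _ HN] := b20.
  exists (P N) => z zr; rewrite cabsC (le_trans (HH _ zr N))//.
  have /= := HN N (leqnn N); rewrite sub0r normrN => h.
  by rewrite ltW// (le_lt_trans (ler_norm _) h).
move=> x xr.
have xr' : cabs (x%:C - x0%:C) <= rho by rewrite -rmorphB cabs_real.
have xr2 : `|x - x0| < r by rewrite (le_lt_trans xr)// /rho /s; lra.
apply/eqP; rewrite -subr_eq0 -cabs_eq0 eq_le cabs_ge0 andbT.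
apply/ler_addgt0Pl => e e0; rewrite addr0.
have e2 : 0 < e / 2 by rewrite divr_gt0.
have [N HN] := cf _ xr2 _ e2.
have /cvgrPdist_lt/(_ _ e2)[M _ HM] := b20.
pose n := maxn N M; have := HN n (leq_maxl _ _); have /= := HM n (leq_maxr _ _).
rewrite sub0r normrN => hb.
have -> : \sum_(k < n) c k * (x - x0)%:C ^+ k = (P n).[x%:C].
  by rewrite PE; under eq_bigr do rewrite rmorphB.
have := HH _ xr' n; rewrite cabsC.
have := cabsB_trans (P n).[x%:C] (H x%:C) (f x).
have := le_lt_trans (ler_norm _) hb; lra.
Qed.

End Extension.

(** * Holomorphic functions on a strip *)

Section Strip.
Context {R : realType}.
Local Notation C := R[i].

Lemma cabs_sub_Re (z : C) : cabs (z - (Re z)%:C) = `|Im z|.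
Proof. by case: z => a b; rewrite /= subrr expr0n /= add0r oppr0 addr0 sqrtr_sqr. Qed.

Lemma Re_dist_le (z : C) (x : R) : `|Re z - x| <= cabs (z - x%:C).
Proof. by case: z => a b; exact: (normr_Re_le ((a +i* b) - x%:C)). Qed.

Lemma Im_dist_le (z : C) (x : R) : `|Im z| <= cabs (z - x%:C).
Proof. by case: z => a b; have := normr_Im_le ((a +i* b) - x%:C); rewrite /= oppr0 addr0. Qed.

(** The points x1 + d / (j + 1) provide as many zeros of the difference as the
identity theorem asks for.  The interval of agreement is not centred at x, so
that agreement can be propagated from one disc to a neighbouring one. *)
Lemma disc_algebra_real_unique (x r x1 d : R) (H1 H2 : C -> C) : 0 < r ->
    disc_algebra x%:C r H1 -> disc_algebra x%:C r H2 ->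
    0 < d -> `|x1 - x| + d <= r / 4 ->
    (forall t : R, `|t - x1| <= d -> H1 t%:C = H2 t%:C) ->
  forall z, cabs (z - x%:C) <= r / 4 -> H1 z = H2 z.
Proof.
move=> r0 h1 h2 d0 x1d E z zc; apply/eqP; rewrite -subr_eq0; apply/eqP.
have h := disc_algebraD h1 (disc_algebraN h2).
apply: (disc_algebra_eq0 r0 h) => // k.
pose p (j : nat) : R := x1 + d / j.+1%:R.
have px j : `|p j - x1| <= d.
  rewrite /p addrC addKr ger0_norm; last by rewrite divr_ge0// ltW.
  by rewrite ler_pdivrMr ?ltr0Sn// ler_peMr ?ler1n// ltW.
exists [seq (p j)%:C | j <- iota 0 k].
  split; last by rewrite size_map size_iota.
  rewrite map_inj_uniq ?iota_uniq// => i j /complexI/addrI/mulfI.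
  move=> /(_ (lt0r_neq0 d0))/invr_inj/eqP.
  by rewrite eqr_nat eqSS => /eqP.
move=> _ /mapP[j _ ->]; rewrite -rmorphB cabs_real; split; last first.
  by rewrite E ?subrr.
by have := px j; have := ler_distD x1 (p j) x; lra.
Qed.

Lemma periodic_int (T : Type) (f : R -> T) (m : int) x :
  (forall t, f (t + 1) = f t) -> f (x + m%:~R) = f x.
Proof.
move=> fp; have pos n y : f (y + n%:R) = f y.
  by elim: n y => [|n IH] y; rewrite ?addr0// mulrSr addrA fp IH.
case: m => n; first exact: pos.
by rewrite NegzE mulrNz -{2}[x](subrK n.+1%:R) pos.
Qed.

(** Periodic functions, holomorphic on the strip of half-width r.  Only discs
with real centre are used: they fill the strip, and polynomial approximation on
each of them is all that the local arguments need. *)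
Definition strip_holomorphic (r : R) (V : C -> C) : Prop :=
  (forall z, V (z + 1) = V z) /\ forall x : R, disc_algebra x%:C r V.

(** A periodic function that extends holomorphically near each real point
extends to a strip: the discs have a uniform radius by compactness of the
circle, and the local extensions agree since they agree on the real axis. *)
Lemma strip_extension (f : R -> C) : periodic f 1 ->
    (forall x0 : R, exists2 r : R, 0 < r & exists2 H, disc_algebra x0%:C r H &
      forall x : R, `|x - x0| <= r -> H x%:C = f x) ->
  exists2 r : R, 0 < r & exists2 V, strip_holomorphic r V &
    forall x : R, V x%:C = f x.
Proof.
move=> fp floc.
pose ext r x0 := exists2 H, disc_algebra x0%:C r H &
  forall x : R, `|x - x0| <= r -> H x%:C = f x.
have [||r r0 ext01] := @segment_uniform_scale R ext 0 1.
- move=> r x r' x' [H h Hf] xx'; exists H.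
    by apply: disc_algebraS h; rewrite -rmorphB cabs_real.
  move=> t tx'; apply: Hf; have := ler_distD x' t x; lra.
- by move=> x _; exact: floc.
have {ext01} ext_all x : ext r x.
  pose m := Num.floor x; have [|H h Hf] := ext01 (x - m%:~R).
    have /andP[] := floor_itv x; rewrite intrD1 -/m; lra.
  exists (fun z => H (z + (- m%:~R)%:C)).
    by apply: disc_algebra_shift; rewrite -rmorphD.
  move=> t tx; rewrite -rmorphD Hf; last first.
    by have -> : t + - m%:~R - (x - m%:~R) = t - x by ring.
  by rewrite -mulrNz periodic_int.
have /choice[G GP] : forall x, exists H, disc_algebra x%:C r H /\
    forall t : R, `|t - x| <= r -> H t%:C = f t.
  by move=> x; have [H h1 h2] := ext_all x; exists H.
pose fl (z : C) : R := (Num.floor (Re z))%:~R.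
pose V z := G (Re z - fl z) (z - (fl z)%:C).
have r8 : 0 < r / 8 by rewrite divr_gt0.
(* V is defined by the disc at the integer part of Re z; it agrees with the
   extension on any disc that contains z, as both agree on the real axis. *)
have VG x z : cabs (z - x%:C) <= r / 8 -> V z = G x z.
  move=> zx; pose y := Re z.
  have r2 : 0 < r / 2 by rewrite divr_gt0.
  have xy : `|y - x| <= r / 8 by rewrite (le_trans (Re_dist_le _ _)).
  have [gy gyf] := GP (y - fl z); have [gx gxf] := GP x.
  have hy : disc_algebra y%:C (r / 2) (fun w => G (y - fl z) (w + (- fl z)%:C)).
    apply: disc_algebra_shift; apply: disc_algebraS gy.
    by rewrite -rmorphD subrr Normc.normc0 add0r; lra.
  have hx : disc_algebra y%:C (r / 2) (G x).
    by apply: disc_algebraS gx; rewrite -rmorphB cabs_real; lra.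
  have := disc_algebra_real_unique r2 hy hx r8 (x1 := y) _ _ (z := z).
  rewrite /V -/y rmorphN; apply.
  - by rewrite subrr normr0 add0r; lra.
    move=> t ty; rewrite -rmorphB gyf; last first.
      have -> : t - fl z - (y - fl z) = t - y by ring.
      by lra.
    rewrite gxf; last by have := ler_distD y t x; lra.
    by rewrite /fl -mulrNz periodic_int.
  by rewrite cabs_sub_Re (le_trans (Im_dist_le z x))//; lra.
exists (r / 8) => //; exists V; first split.
- move=> z; rewrite /V /fl; have -> : Re (z + 1) = Re z + 1 by case: z.
  rewrite floorDrz ?rpred1// floor1 intrD1 rmorphD opprD addrACA subrr addr0.
  by rewrite rmorph1 opprD addrACA subrr addr0.
- move=> x; have [gx _] := GP x; have : disc_algebra x%:C (r / 8) (G x).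
    by apply: disc_algebraS gx; rewrite subrr Normc.normc0; lra.
  by apply: disc_algebra_ext => z /VG.
move=> x; rewrite (VG x) ?subrr ?Normc.normc0 ?(ltW r8)//.
by have [_ ->//] := GP x; rewrite subrr normr0 ltW.
Qed.

Section Closure.
Variable r : R.

Lemma strip_cst a : strip_holomorphic r (fun=> a).
Proof. by split=> // x; exact: disc_algebra_cst. Qed.

Lemma stripD V1 V2 : strip_holomorphic r V1 -> strip_holomorphic r V2 ->
  strip_holomorphic r (fun z => V1 z + V2 z).
Proof.
move=> [p1 h1] [p2 h2]; split=> [z|x]; first by rewrite p1 p2.
exact: disc_algebraD.
Qed.

Lemma stripM V1 V2 : strip_holomorphic r V1 -> strip_holomorphic r V2 ->
  strip_holomorphic r (fun z => V1 z * V2 z).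
Proof.
move=> [p1 h1] [p2 h2]; split=> [z|x]; first by rewrite p1 p2.
exact: disc_algebraM.
Qed.

Lemma strip_shift (t : R) V : strip_holomorphic r V ->
  strip_holomorphic r (fun z => V (z + t%:C)).
Proof.
move=> [p h]; split=> [z|x]; first by rewrite addrAC p.
by apply: disc_algebra_shift; rewrite -rmorphD; exact: h.
Qed.

Lemma strip_prod I (s : seq I) (V : I -> C -> C) :
  (forall i, strip_holomorphic r (V i)) ->
  strip_holomorphic r (fun z => \prod_(i <- s) V i z).
Proof.
move=> h; split=> [z|x]; first by apply: eq_bigr => i _; have [->] := h i.
by apply: disc_algebra_prod => i; have [_] := h i.
Qed.

End Closure.

Lemma strip_periodic (r : R) V (m : int) z : strip_holomorphic r V ->
  V (z + (m%:~R)%:C) = V z.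
Proof.
move=> [p _]; have fp : periodic (fun x : R => V (z + x%:C)) 1.
  by move=> x; rewrite rmorphD addrA p.
by have := periodic_int m 0 fp; rewrite add0r addr0.
Qed.

Lemma strip_sub (r r' : R) V : r' <= r -> strip_holomorphic r V ->
  strip_holomorphic r' V.
Proof.
move=> rr' [p h]; split=> // x; apply: disc_algebraS (h x).
by rewrite subrr Normc.normc0 add0r.
Qed.

(** The uniform radius and the bound come from compactness of the circle; one
parameter s plays both roles, radius s and bound 1 / s, so that the property
passes to subintervals. *)
Lemma strip_bounded (r : R) V : 0 < r -> strip_holomorphic r V ->
  exists2 s : R, 0 < s <= r & exists2 B : R, 0 < B &
    forall z, `|Im z| <= s -> cabs (V z) <= B.
Proof.
move=> r0 hV; have [p h] := hV.
pose P s x := forall z, cabs (z - x%:C) <= s -> cabs (V z) <= s^-1.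
have [||s s0 bnd] := @segment_uniform_scale R (fun s x => 0 < s -> P s x) 0 1.
- move=> s x s' x' Px xx' s'0 z zx'.
  have ss' : s' <= s by rewrite (le_trans _ xx')// lerDr.
  have s0 : 0 < s by exact: lt_le_trans ss'.
  rewrite (@le_trans _ _ s^-1)//; last by rewrite lef_pV2.
  apply: (Px s0); rewrite (le_trans (cabsB_trans x'%:C _ _))//.
  by rewrite -rmorphB cabs_real addrC (le_trans _ xx')// lerD2l.
- move=> x _; have [B B0 HB] := disc_algebra_bounded (h x).
  exists (Num.min r B^-1); first by rewrite lt_min r0 invr_gt0.
  move=> m0 z; rewrite le_min => /andP[zr _]; rewrite (le_trans (HB _ zr))//.
  by rewrite -[leLHS]invrK lef_pV2 ?posrE ?invr_gt0// ge_min lexx orbT.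
exists (Num.min s r); first by rewrite lt_min s0 r0 ge_min lexx orbT.
exists s^-1; first by rewrite invr_gt0.
move=> z; rewrite le_min => /andP[zs _].
pose m := Num.floor (Re z); rewrite -(strip_periodic (- m) z hV).
apply: (bnd (Re z - m%:~R)) => //.
  by have /andP[] := floor_itv (Re z); rewrite intrD1 -/m; lra.
rewrite mulrNz rmorphB rmorphN opprB addrA subrK.
by rewrite cabs_sub_Re.
Qed.

End Strip.

(** * The maximum principle on a strip *)

Section MaximumPrinciple.
Context {R : realType}.
Local Notation C := R[i].

Lemma strip_modulus_continuous (r : R) (H : C -> C) (p : R * R) :
  strip_holomorphic r H -> `|p.2| < r ->
  {for p, continuous (fun q : R * R => cabs (H (q.1 +i* q.2)))}.
Proof.
move=> [_ h] pr; apply/cvgrPdist_lt => e e0.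
have cp : cabs ((p.1 +i* p.2) - (p.1)%:C) = `|p.2|.
  by rewrite (cabs_sub_Re (p.1 +i* p.2)).
have [d d0 Hd] : exists2 d : R, 0 < d & forall z,
    cabs (z - (p.1)%:C) <= r -> cabs (z - (p.1 +i* p.2)) < d ->
    cabs (H z - H (p.1 +i* p.2)) < e.
  by apply: disc_algebra_continuous (h p.1) _ e0; rewrite cp ltW.
pose d' := Num.min (d / 2) ((r - `|p.2|) / 2).
have d'0 : 0 < d' by rewrite lt_min !divr_gt0// subr_gt0.
have : \forall q \near p, ball p d' q by exact: nbhsx_ballx.
apply: filterS => -[x y] [/=]; rewrite -!ball_normE /= => xd yd.
have zd : cabs ((x +i* y) - (p.1 +i* p.2)) < 2 * d'.
  rewrite (le_lt_trans (cabs_le_ReIm _))//=.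
  by rewrite (distrC x) (distrC y) mulr2n mulrDl mul1r ltrD.
rewrite (le_lt_trans (cabs_lerB_dist _ _))// cabsC; apply: Hd.
  rewrite (le_trans (cabsB_trans (p.1 +i* p.2) _ _))// cp.
  have : d' <= (r - `|p.2|) / 2 by rewrite ge_min lexx orbT.
  by move: zd; lra.
by have : d' <= d / 2 by [rewrite ge_min lexx]; move: zd; lra.
Qed.

Lemma prim_root_Im_sum n (z : C) : n.-primitive_root z -> (2 < n)%N ->
  \sum_(j < n) Im (z ^+ j) = 0.
Proof.
move=> zn n2; have := prim_root_sum 1 zn; rewrite expr1 gtnNdvd ?(ltnW n2)//.
by move/(congr1 Im); rewrite (raddf_sum (@complex.Im R : Rcomplex R -> R)).
Qed.

Lemma prim_root_Im_sqr_sum n (z : C) : n.-primitive_root z -> (2 < n)%N ->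
  \sum_(j < n) Im (z ^+ j) ^+ 2 = n%:R / 2.
Proof.
move=> zn n2; have := prim_root_sum 2 zn; rewrite gtnNdvd//.
move/(congr1 Re); rewrite (raddf_sum (@complex.Re R : Rcomplex R -> R)) /= => S.
have E j : Im (z ^+ j) ^+ 2 = 2^-1 - 2^-1 * Re ((z ^+ 2) ^+ j).
  have : cabs (z ^+ j) = 1 by rewrite cabsX (cabs_prim_root zn) expr1n.
  rewrite exprAC; case: (z ^+ j) => a b /=.
  move=> /(congr1 (fun t => t ^+ 2)); rewrite expr1n sqr_sqrtr.
    by move=> ab; rewrite -!expr2; lra.
  by rewrite addr_ge0 ?sqr_ge0.
under eq_bigr do rewrite E.
by rewrite sumrB -mulr_sumr S mulr0 subr0 sumr_const card_ord mulr_natl.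
Qed.

(** The maximum principle on a strip.  The summand k y ^ 2 makes the mean over
a small circle of |H| ^ 2 + k y ^ 2 strictly larger than its value at the
centre, so this function has no interior maximum; a maximum exists because
periodicity makes the strip compact. *)
Lemma strip_maximum_principle (r h B : R) (H : C -> C) :
    0 < h < r -> 0 <= B -> strip_holomorphic r H ->
    (forall z, `|Im z| = h -> cabs (H z) <= B) ->
  forall z, `|Im z| <= h -> cabs (H z) <= B.
Proof.
move=> /andP[h0 hr] B0 hH HB z0 z0h; rewrite leNgt; apply/negP => Bz0.
have [Hp HD] := hH.
pose k : R := (cabs (H z0) ^+ 2 - B ^+ 2) / (2 * h ^+ 2).
have hh0 : 0 < h ^+ 2 by rewrite exprn_gt0.
have BH : B ^+ 2 < cabs (H z0) ^+ 2 by rewrite ltrXn2r ?nnegrE ?cabs_ge0.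
have k0 : 0 < k by rewrite divr_gt0 ?subr_gt0// mulr_gt0.
have kh : k * h ^+ 2 = (cabs (H z0) ^+ 2 - B ^+ 2) / 2.
  by rewrite /k; field; rewrite gt_eqF.
pose phi (q : R * R) := cabs (H (q.1 +i* q.2)) ^+ 2 + k * q.2 ^+ 2.
pose K := `[0, 1]%classic `*` `[- h, h]%classic : set (R * R).
have cK : compact K by apply: compact_setX; exact: segment_compact.
have K0 : K !=set0.
  by exists (0, 0); split; rewrite /= in_itv /= ?lexx ?ler01 ?oppr_le0 ?ltW.
have cphi : {within K, continuous phi}.
  apply: continuous_in_subspaceT => q; rewrite inE => -[_ /=].
  rewrite in_itv /= -ler_norml => qh.
  have qr : `|q.2| < r by rewrite (le_lt_trans qh).
  have g := strip_modulus_continuous hH qr.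
  rewrite /continuous_at /phi; apply: cvgD.
    under eq_fun do rewrite expr2; rewrite expr2.
    by apply: cvgM.
  apply: cvgM; first exact: cvg_cst.
  under eq_fun do rewrite expr2; rewrite expr2.
  by apply: cvgM; exact: cvg_snd.
have [[/= x y]] := compact_EVT_max K0 cK cphi.
rewrite inE => -[/= _]; rewrite in_itv /= -ler_norml => yh phimax.
have {phimax} phimax z : `|Im z| <= h -> cabs (H z) ^+ 2 + k * Im z ^+ 2 <=
    cabs (H (x +i* y)) ^+ 2 + k * y ^+ 2.
  move=> zh; pose m := Num.floor (Re z).
  have E t : (Re z - t) +i* Im z = z + (- t)%:C.
    by case: (z) => a b /=; simpc.
  have := phimax (Re z - m%:~R, Im z); rewrite inE /phi /= E -mulrNz.
  rewrite (strip_periodic _ _ hH); apply; split; rewrite /= in_itv /=.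
    by have /andP[] := floor_itv (Re z); rewrite intrD1 -/m; lra.
  by rewrite -ler_norml.
have [yh'|yh'] := eqVneq `|y| h.
  have := phimax z0 z0h; have := HB (x +i* y) yh'.
  rewrite -(real_normK (num_real y)) yh' kh => HxB.
  have : cabs (H (x +i* y)) ^+ 2 <= B ^+ 2 by rewrite lerXn2r ?nnegrE ?cabs_ge0.
  have : 0 <= k * Im z0 ^+ 2 by rewrite mulr_ge0 ?sqr_ge0// ltW.
  by lra.
have {}yh : `|y| < h by rewrite lt_neqAle yh' yh.
pose w : C := x +i* y; pose s := h - `|y|; have s0 : 0 < s by rewrite subr_gt0.
pose A : R := cabs (H w); have A0 : 0 <= A by exact: cabs_ge0.
(* The error e of the polynomial approximation is chosen so that it cannot
   absorb the gain k s ^ 2 / 2 produced by the strictly convex term. *)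
pose e : R := k * s ^+ 2 / (16 * (A + 1)).
have A10 : 0 < A + 1 by rewrite ltr_wpDl.
have e0 : 0 < e by apply: divr_gt0; rewrite mulr_gt0// exprn_gt0.
have Ae : 4 * A * e < k * s ^+ 2 / 2.
  have -> : k * s ^+ 2 = 16 * (A + 1) * e by rewrite /e; field; rewrite gt_eqF.
  rewrite -subr_gt0 (_ : _ - _ = 4 * A * e + 8 * e); last by field.
  by have := mulr_ge0 A0 (ltW e0); lra.
have [P HP] := HD x e e0.
pose n := maxn (size P) 3; have n2 : (2 < n)%N by rewrite leq_max orbT.
have n0 : (0 < n)%N by exact: leq_trans n2.
have [z zn] := @complex_prim_root R n n0.
pose u j := w + s%:C * z ^+ j.
have nR0 : (0 : R) < n%:R by rewrite ltr0n.
have zj j : cabs (z ^+ j) = 1 by rewrite cabsX (cabs_prim_root zn) expr1n.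
have uw j : cabs (u j - w) = s.
  by rewrite addrC addKr Normc.normcM zj cabs_real_ge0 ?mulr1// ltW.
have wx : cabs (w - x%:C) = `|y| by rewrite (cabs_sub_Re w).
have ux j : cabs (u j - x%:C) <= h.
  by rewrite (le_trans (cabsB_trans w _ _))// uw wx /s subrK.
have uIm j : Im (u j) = y + s * Im (z ^+ j).
  by rewrite /u /w; case: (z ^+ j) => a b; simpc.
have uh j : `|Im (u j)| <= h by rewrite (le_trans (Im_dist_le _ x)).
have mean := prim_root_mean w s%:C zn (leq_maxl _ _).
(* The mean value property, up to the approximation error. *)
have Amean : n%:R * A <= \sum_(j < n) cabs (H (u j)) + n%:R * (2 * e).
  have PA : A - e <= cabs P.[w].
    have := HP w; rewrite wx => /(_ (ltW (lt_trans yh hr))).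
    by have := cabsD (H w - P.[w]) P.[w]; rewrite subrK -/A; lra.
  have : n%:R * cabs P.[w] <= \sum_(j < n) (cabs (H (u j)) + e).
    rewrite -(cabs_nat n) -Normc.normcM -mean (le_trans (cabs_sum _ _))//.
    apply: ler_sum => j _; rewrite -/(u j).
    have := HP (u j) (le_trans (ux j) (ltW hr)); rewrite cabsC.
    by have := cabsD (P.[u j] - H (u j)) (H (u j)); rewrite subrK; lra.
  rewrite big_split /= sumr_const card_ord -[e *+ n]mulr_natl.
  by have := ler_wpM2l (ltW nR0) PA; rewrite mulrBr; lra.
(* The inequality passes to squares because (|H| - A) ^ 2 >= 0. *)
have sum1 : n%:R * A ^+ 2 - n%:R * (4 * A * e) <= \sum_(j < n) cabs (H (u j)) ^+ 2.
  have : \sum_(j < n) (2 * A * cabs (H (u j)) - A ^+ 2) <=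
         \sum_(j < n) cabs (H (u j)) ^+ 2.
    apply: ler_sum => j _; rewrite -subr_ge0.
    have -> : cabs (H (u j)) ^+ 2 - (2 * A * cabs (H (u j)) - A ^+ 2) =
       (cabs (H (u j)) - A) ^+ 2 by ring.
    exact: sqr_ge0.
  apply: le_trans; rewrite sumrB -mulr_sumr sumr_const card_ord.
  rewrite -[A ^+ 2 *+ n]mulr_natl.
  have := ler_wpM2l (mulr_ge0 (ler0n R 2) A0) Amean.
  set S := \sum_(_ < _) _; rewrite [in X in _ -> X]expr2; lra.
have sum2 : \sum_(j < n) Im (u j) ^+ 2 = n%:R * y ^+ 2 + n%:R * (s ^+ 2 / 2).
  have E j : Im (u j) ^+ 2 =
      y ^+ 2 + 2 * y * s * Im (z ^+ j) + s ^+ 2 * Im (z ^+ j) ^+ 2.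
    by rewrite uIm; ring.
  under eq_bigr do rewrite E.
  rewrite !big_split /= sumr_const card_ord -!mulr_sumr.
  by rewrite prim_root_Im_sum// prim_root_Im_sqr_sum// -mulr_natl; ring.
have : \sum_(j < n) (cabs (H (u j)) ^+ 2 + k * Im (u j) ^+ 2) <=
       \sum_(j < n) (A ^+ 2 + k * y ^+ 2).
  by apply: ler_sum => j _; exact: phimax.
rewrite sumr_const card_ord -[(A ^+ 2 + _) *+ n]mulr_natl.
rewrite big_split /= -mulr_sumr sum2.
have := ltr_pM2l nR0 (4 * A * e) (k * s ^+ 2 / 2); rewrite Ae.
move: sum1; set S := \sum_(_ < _) _; lra.
Qed.

End MaximumPrinciple.

(** * Translation invariance of the integral over a period *)

Section Translation.
Context {R : realType}.
Local Notation mu := (@lebesgue_measure R).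

Lemma measurable_translation (t : R) (D : set R) :
  measurable_fun D (fun x : R => x + t).
Proof. exact: measurable_funD. Qed.

Lemma lebesgue_measure_translation (t : R) (A : set R) : measurable A ->
  mu A = pushforward mu (fun x : R => x + t) A.
Proof.
pose tau (x : measurableTypeR R) : measurableTypeR R := x + t.
have mtau : measurable_fun [set: measurableTypeR R] tau.
  exact: measurable_translation.
pose nu := measure_function_pushforward__canonical__measure_function_Measure mu mtau.
apply: (lebesgue_measure_unique (mu := nu)).
move=> _ [[a b] _ <-]; rewrite /= /pushforward /=.
have -> : tau @^-1` [set` `]a, b]] = [set` `]a - t, b - t]].
  by apply/seteqP; split=> x /=; rewrite !in_itv/= /tau; lra.
rewrite !lebesgue_measure_itv /= !lte_fin ltrD2r; case: ifP => // _.
by rewrite -!EFinD opprD opprK addrACA addNr addr0.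
Qed.

Lemma ge0_integral_translation (t : R) (A : set R) (f : R -> \bar R) :
  measurable A -> measurable_fun A f -> (forall x, 0 <= f x)%E ->
  (\int[mu]_(x in A) f x =
   \int[mu]_(x in [set x | A (x + t)%R]) f ((x : R) + t)%R)%E.
Proof.
move=> mA mf f0.
pose tau (x : measurableTypeR R) : measurableTypeR R := x + t.
have mtau : measurable_fun [set: measurableTypeR R] tau.
  exact: measurable_translation.
rewrite -(@ge0_integral_pushforward _ _ _ _ _ tau mtau mu A f)//.
apply: eq_measure_integral => B mB _.
exact: (lebesgue_measure_translation t mB).
Qed.

(** By periodicity only the fractional part s of t matters; the part of the
shifted period beyond 1 is moved back to the start of the original one. *)
Lemma periodic_integral_shift (t : R) (f : R -> \bar R) :
    measurable_fun setT f -> (forall x, f (x + 1) = f x) ->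
  (\int[mu]_(x in `[0%R, 1%R]) f ((x : R) + t)%R =
   \int[mu]_(x in `[0%R, 1%R]) f x)%E.
Proof.
suff ge0 (g : R -> \bar R) : measurable_fun setT g ->
    (forall x, 0 <= g x)%E -> (forall x, g (x + 1) = g x) ->
  (\int[mu]_(x in `[0%R, 1%R]) g ((x : R) + t)%R =
   \int[mu]_(x in `[0%R, 1%R]) g x)%E.
  move=> mf fp; rewrite [LHS]integralE [RHS]integralE.
  have fpE : (fun x => f (x + t)%R)^\+%E = (fun x => f^\+%E (x + t)%R).
    exact: (funepos_comp f (fun x => x + t)).
  have fnE : (fun x => f (x + t)%R)^\-%E = (fun x => f^\-%E (x + t)%R).
    exact: (funeneg_comp f (fun x => x + t)).
  rewrite fpE fnE !ge0//.
  - exact: measurable_funeneg.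
  - by move=> x; rewrite !funenegE fp.
  - exact: measurable_funepos.
  - by move=> x; rewrite !funeposE fp.
move=> mg g0 gp.
pose s : R := t - (Num.floor t)%:~R.
have /andP[s0 s1] : 0 <= s < 1.
  by have /andP[] := floor_itv t; rewrite intrD1 /s; lra.
have gs x : g (x + t) = g (x + s).
  by rewrite /s addrA -mulrNz periodic_int.
under eq_integral do rewrite gs.
have mgs : measurable_fun setT (fun x : R => g (x + s)).
  apply: (@measurableT_comp _ _ _ _ _ _ g _ (fun x : R => x + s) mg).
  exact: measurable_translation.
rewrite -!integral_itv_bndo_bndc; [|exact: measurable_funTS..].
have mS (A : set R) : measurable_fun A g by exact: measurable_funTS.
transitivity (\int[mu]_(x in `[s, (1 + s)%R[) g x)%E.
  rewrite [RHS](ge0_integral_translation s)//.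
  congr (integral _ _ _); apply/seteqP; split=> x /=; rewrite !in_itv /=; lra.
have -> : `[s, 1 + s[%classic = `[s, 1[%classic `|` `[1, 1 + s[%classic :> set R.
  apply/seteqP; split=> x /=; rewrite !in_itv /=.
    by case: (ltP x 1) => ? /andP[? ?]; [left|right]; apply/andP.
  by case; lra.
have dj (a b c : R) : [disjoint `[a, b[%classic & `[b, c[%classic].
  by apply/disj_setPS => x [] /=; rewrite !in_itv /=; lra.
rewrite (ge0_integral_setU mu _ _ (mS _) (fun x _ => g0 x) (dj _ _ _))//.
have -> : (\int[mu]_(x in `[1%R, (1 + s)%R[) g x = \int[mu]_(x in `[0%R, s[) g x)%E.
  rewrite [LHS](ge0_integral_translation 1)//; under eq_integral do rewrite gp.
  congr (integral _ _ _); apply/seteqP; split=> x /=; rewrite !in_itv /=; lra.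
rewrite addeC -(ge0_integral_setU mu _ _ (mS _) (fun x _ => g0 x) (dj _ _ _))//.
congr (integral _ _ _); apply/seteqP; split=> x /=; rewrite !in_itv /=.
  by case; lra.
by case: (ltP x s) => ? /andP[? ?]; [left|right]; apply/andP.
Qed.

End Translation.

(** * Integrals over the circle *)

Section CircleIntegral.
Context {R : realType}.
Local Notation C := R[i].
Local Notation mu := (@lebesgue_measure R).
Local Notation D := (`[0, 1]%classic : set R).
Local Notation cint f := (\int[mu]_(x in D) f x).
Local Notation cintegrable f := (mu.-integrable D (EFin \o f)).

Lemma circle_integrable_continuous (f : R -> R) :
  continuous f -> cintegrable f.
Proof.
move=> cf; apply: continuous_compact_integrable; first exact: segment_compact.
exact: continuous_subspaceT.
Qed.

Lemma circle_integrable_shift (t : R) (f : R -> R) : measurable_fun setT f ->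
  periodic f 1 -> cintegrable f -> cintegrable (fun x => f (x + t)).
Proof.
move=> mf fp /integrableP[_ fi]; apply/integrableP; split.
  apply/measurable_EFinP/measurable_funTS.
  apply: (@measurableT_comp _ _ _ _ _ _ f _ (fun x : R => x + t) mf).
  exact: measurable_translation.
rewrite (periodic_integral_shift t (f := fun x => `|(f x)%:E|%E))//.
  by apply/measurable_EFinP; exact: measurableT_comp.
by move=> x; rewrite fp.
Qed.

Lemma circle_integral_shift (t : R) (f : R -> R) : measurable_fun setT f ->
  periodic f 1 -> cint (fun x => f (x + t)) = cint f.
Proof.
move=> mf fp; rewrite /Rintegral; congr fine.
rewrite (periodic_integral_shift t (f := fun x => (f x)%:E))//.
  exact/measurable_EFinP.
by move=> x; rewrite fp.
Qed.

Lemma circle_integral_sum I (s : seq I) (f : I -> R -> R) :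
  (forall i, cintegrable (f i)) ->
  cint (fun x => \sum_(i <- s) f i x) = \sum_(i <- s) cint (f i).
Proof.
move=> fi; elim: s => [|i s IH].
  under eq_Rintegral do rewrite big_nil.
  by rewrite big_nil Rintegral_cst// mul0r.
under eq_Rintegral do rewrite big_cons.
rewrite RintegralD ?IH ?big_cons//.
rewrite (_ : _ \o _ = (fun x => \sum_(i <- s) (EFin \o f i) x)%E).
  exact: integrable_sum.
by apply/funext => x /=; rewrite sumEFin.
Qed.

Lemma circle_integrable_sum I (s : seq I) (f : I -> R -> R) :
  (forall i, cintegrable (f i)) ->
  cintegrable (fun x => \sum_(i <- s) f i x).
Proof.
move=> fi; rewrite (_ : _ \o _ = (fun x => \sum_(i <- s) (EFin \o f i) x)%E).
  exact: integrable_sum.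
by apply/funext => x /=; rewrite sumEFin.
Qed.

Lemma circle_integrableD (f g : R -> R) : cintegrable f -> cintegrable g ->
  cintegrable (fun x => f x + g x).
Proof. by move=> fi gi; exact: (integrableD _ fi gi). Qed.

Lemma circle_integrableB (f g : R -> R) : cintegrable f -> cintegrable g ->
  cintegrable (fun x => f x - g x).
Proof. by move=> fi gi; exact: (integrableB _ fi gi). Qed.

Lemma circle_integralD (f g : R -> R) : cintegrable f -> cintegrable g ->
  cint (fun x => f x + g x) = cint f + cint g.
Proof. by move=> fi gi; rewrite RintegralD. Qed.

Lemma circle_integralB (f g : R -> R) : cintegrable f -> cintegrable g ->
  cint (fun x => f x - g x) = cint f - cint g.
Proof. by move=> fi gi; rewrite RintegralB. Qed.

Lemma circle_integral_EFin (f : R -> R) : cintegrable f ->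
  (\int[mu]_(x in D) (f x)%:E = (cint f)%:E)%E.
Proof. by move=> fi; rewrite /Rintegral fineK//; exact: integrable_fin_num. Qed.

Lemma circle_integral_cst (c : R) : cint (fun=> c) = c.
Proof.
rewrite Rintegral_cst//= lebesgue_measure_itv /= lte_fin ltr01 oppr0 adde0 /=.
by rewrite mulr1.
Qed.

Lemma periodic_uniformly_continuous (u : R -> R) (d : R) :
    continuous u -> periodic u 1 -> 0 < d ->
  exists2 e : R, 0 < e & forall x y, `|x - y| <= e -> `|u x - u y| <= d.
Proof.
move=> cu up d0.
pose P (e x : R) := forall y z, `|y - x| <= e -> `|z - x| <= e ->
  `|u y - u z| <= d.
have [||e e0 He] := @segment_uniform_scale R P 0 1.
- move=> e x e' x' Px xx' y z yx zx; apply: Px.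
    by have := ler_distD x' y x; lra.
  by have := ler_distD x' z x; lra.
- move=> x _; have d2 : 0 < d / 2 by rewrite divr_gt0.
  have /cvgrPdist_lt/(_ _ d2)/nbhs_ballP[e /= e0 He] := cu x.
  exists (e / 2); first by rewrite divr_gt0.
  have near y : `|y - x| <= e / 2 -> `|u x - u y| < d / 2.
    by move=> yx; apply: He; rewrite -ball_normE /= distrC; lra.
  move=> y z /near hy /near hz; have := ler_distD (u x) (u y) (u z).
  by rewrite (distrC (u y) (u x)); lra.
exists e => // x y xy; pose m := Num.floor x.
have um z : u (z - m%:~R) = u z by rewrite -mulrNz periodic_int.
rewrite -(um x) -(um y); apply: (He (x - m%:~R)).
- by have /andP[] := floor_itv x; rewrite intrD1 -/m; lra.
- by rewrite subrr normr0 ltW.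
- have -> : y - m%:~R - (x - m%:~R) = y - x by ring.
  by rewrite distrC.
Qed.

(** A sum over n equidistant points is 1/n-periodic in its base point x, so by
uniform continuity it varies little with x; and its mean over x is n times that
of u.  The bound is therefore uniform in the base point. *)
Lemma periodic_riemann_sum (u : R -> R) (d : R) :
    continuous u -> periodic u 1 -> 0 < d ->
  exists2 n, (0 < n)%N & forall x,
    \sum_(j < n) u (x + j%:R / n%:R) <= n%:R * (cint u + d).
Proof.
move=> cu up d0; have [e e0 He] := periodic_uniformly_continuous cu up d0.
have mu_u : measurable_fun setT u by exact: continuous_measurable_fun.
pose n := (Num.truncn e^-1).+1; exists n => // x.
have n0 : (0 : R) < n%:R by rewrite ltr0n.
have ne : n%:R^-1 <= e.
  rewrite -[e]invrK lef_pV2 ?posrE ?invr_gt0//.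
  by rewrite ltW// truncnS_gt.
pose S t := \sum_(j < n) u (t + j%:R / n%:R).
have Sper t (k : nat) : S (t + k%:R / n%:R) = S t.
  elim: k t => [|k IH] t; first by rewrite mul0r addr0.
  rewrite mulrSr mulrDl mul1r addrA -[RHS]IH.
  move: (t + k%:R / n%:R) => s; rewrite /S big_ord_recr /= [RHS]big_ord_recl /=.
  rewrite addrC mul0r addr0; congr (_ + _).
    rewrite -[in RHS](up s) -addrA; congr (u (s + _)).
    have -> : n%:R = (Num.truncn e^-1)%:R + 1 :> R by rewrite /n mulrSr.
    by field; rewrite -mulrSr.
  apply: eq_bigr => j _; rewrite -addrA; congr (u (s + _)).
  by rewrite /bump /= add1n mulrSr; ring.
have SperN t (k : nat) : S (t - k%:R / n%:R) = S t.
  by rewrite -(Sper (t - _) k) subrK.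
have Sz t (k : int) : S (t + k%:~R / n%:R) = S t.
  case: k => k; first exact: Sper.
  by rewrite NegzE mulrNz mulNr SperN.
have close t : S x <= S t + n%:R * d.
  pose k := Num.floor ((x - t) * n%:R).
  rewrite -(Sz t k) mulr_natl -{2}[n]card_ord -sumr_const -big_split /=.
  apply: ler_sum => j _; rewrite -lerBlDl (le_trans (ler_norm _))// He//.
  rewrite opprD addrACA subrr addr0 (le_trans _ ne)//.
  have /andP[k1 k2] := floor_itv ((x - t) * n%:R).
  have -> : x - (t + k%:~R / n%:R) = ((x - t) * n%:R - k%:~R) / n%:R.
    by field; rewrite gt_eqF.
  rewrite ger0_norm; last by rewrite divr_ge0 ?ler0n// subr_ge0.
  rewrite -[leRHS]mul1r ler_pM2r ?invr_gt0//.
  by move: k2; rewrite intrD1 -/k; lra.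
have iu j : cintegrable (fun t => u (t + j%:R / n%:R)).
  by apply: circle_integrable_shift => //; exact: circle_integrable_continuous.
have iS : cintegrable S by exact: circle_integrable_sum.
have IS : cint S = n%:R * cint u.
  rewrite /S circle_integral_sum//.
  under eq_bigr do rewrite circle_integral_shift//.
  by rewrite sumr_const card_ord mulr_natl.
rewrite mulrDr -IS -lerBlDr -(circle_integral_cst (S x - n%:R * d)).
apply: le_Rintegral => //.
  by apply: circle_integrable_continuous; exact: cst_continuous.
by move=> t _; rewrite lerBlDr.
Qed.

End CircleIntegral.

(** * A lower bound for the mean of log |F| *)

Section LogIntegral.
Context {R : realType}.
Local Notation C := R[i].
Local Notation mu := (@lebesgue_measure R).
Local Notation D := (`[0, 1]%classic : set R).
Local Notation cint f := (\int[mu]_(x in D) f x).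
Local Notation cintegrable f := (mu.-integrable D (EFin \o f)).

(** The disc of radius r about x contains the one of radius r - |y| about
x + i y. *)
Lemma strip_vertical_shift (r y : R) V : strip_holomorphic r V ->
  strip_holomorphic (r - `|y|) (fun z => V (z + y *i)).
Proof.
move=> [p h]; split=> [z|x]; first by rewrite addrAC p.
apply: disc_algebra_shift; apply: disc_algebraS (h x).
rewrite [x%:C + _]addrC addrK (_ : cabs _ = `|y|) ?subrKC//=.
by rewrite expr0n /= add0r sqrtr_sqr.
Qed.

Lemma strip_opp (r : R) V : strip_holomorphic r V ->
  strip_holomorphic r (fun z => V (- z)).
Proof.
move=> [p h]; split=> [z|x]; first by rewrite opprD -[in RHS](subrK 1 (- z)) p.
have := @disc_algebra_affine R x%:C r (-1) 0 V.
rewrite cabsN Normc.normc1 mulN1r addr0 -rmorphN => /(_ erefl (h (- x))).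
by apply: disc_algebra_ext => z _; rewrite mulN1r addr0.
Qed.

Lemma strip_real_continuous (r : R) V : 0 < r -> strip_holomorphic r V ->
  continuous (fun x : R => cabs (V x%:C)).
Proof.
move=> r0 [_ h] x; apply/cvgrPdist_lt => e e0.
have [|d d0 Hd] := disc_algebra_continuous (h x) (z0 := x%:C) _ e0.
  by rewrite subrr Normc.normc0 ltW.
have m0 : 0 < Num.min d r by rewrite lt_min d0.
have : \forall y \near x, ball x (Num.min d r) y by exact: nbhsx_ballx.
apply: filterS => y; rewrite -ball_normE /= lt_min distrC => /andP[yd yr].
rewrite distrC (le_lt_trans (cabs_lerB_dist _ _))//.
by apply: Hd; rewrite -rmorphB cabs_real// ltW.
Qed.

Lemma continuous_ln_max (g : R -> R) (e : R) : 0 < e -> continuous g ->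
  continuous (fun x => ln (Num.max (g x) e)).
Proof.
move=> e0 cg x.
have gx : 0 < Num.max (g x) e by rewrite lt_max e0 orbT.
have cm : Num.max (g y) e @[y --> x] --> Num.max (g x) e.
  under eq_fun do rewrite maxr_absE.
  rewrite maxr_absE; apply: cvgM; last exact: cvg_cst.
  apply: cvgD; first by apply: cvgD; [exact: cg|exact: cvg_cst].
  by apply: cvg_norm; apply: cvgB; [exact: cg|exact: cvg_cst].
exact: (cvg_comp _ _ cm (continuous_ln gx)).
Qed.

(** Let G(z) be the product of the F(z + i y + j / n).  On the line
Im z = - y, log |G| is at most a Riemann sum of the truncated log |F|, hence
at most n times its mean on the real line, at every point and up to a small
error.  On both boundary lines of the strip |Im z| <= y, one of the factors of
G(z) G(- z) is evaluated there and the other one sees F at height 2 y.  The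
maximum principle at z = 0, where both factors see F at height y, gives the
three-lines inequality.  The truncation at level e keeps log |F| continuous. *)
Lemma mean_ln_max_lower_bound (r y m M e : R) (F : C -> C) :
    strip_holomorphic r F -> 0 < y -> 2 * y < r -> 0 < m -> 0 < M -> 0 < e ->
    (forall z, Im z = y -> m <= cabs (F z)) ->
    (forall z, Im z = 2 * y -> cabs (F z) <= M) ->
  2 * ln m - ln M <= cint (fun x => ln (Num.max (cabs (F x%:C)) e)).
Proof.
move=> hF y0 yr m0 M0 e0 Fm FM.
have r0 : 0 < r by rewrite (lt_trans _ yr)// mulr_gt0.
pose u x : R := ln (Num.max (cabs (F x%:C)) e).
have cu : continuous u.
  by apply: continuous_ln_max => //; exact: strip_real_continuous hF.
have up : periodic u 1 by move=> x; rewrite /u rmorphD rmorph1; have [->] := hF.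
apply/ler_addgt0Pr => d d0.
have [n n0 nS] := periodic_riemann_sum cu up d0.
have nR : (0 : R) < n%:R by rewrite ltr0n.
pose G z := \prod_(j < n) F (z + y *i + (j%:R / n%:R)%:C).
have hG : strip_holomorphic (r - y) G.
  apply: strip_prod => j.
  have := strip_vertical_shift y (strip_shift (j%:R / n%:R) hF).
  by rewrite (gtr0_norm y0).
have hH := stripM hG (strip_opp hG).
set I := cint u.
have prodE (c : R) : c ^+ n = \prod_(j < n) c by rewrite prodr_const card_ord.
have GM z : Im z = y -> cabs (G z) <= M ^+ n.
  move=> zy; rewrite cabs_prod prodE.
  apply: ler_prod => j _; rewrite cabs_ge0/= FM//.
  by case: z zy => a b /= ->; rewrite addr0 mulr2n mulrDl mul1r.
have GI z : Im z = - y -> cabs (G z) <= expR (n%:R * (I + d)).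
  move=> zy; rewrite cabs_prod.
  rewrite (@le_trans _ _ (expR (\sum_(j < n) u (Re z + j%:R / n%:R))))//; last first.
    by rewrite ler_expR; exact: nS.
  rewrite expR_sum; apply: ler_prod => j _; rewrite cabs_ge0/= /u lnK; last first.
    by rewrite posrE lt_max e0 orbT.
  have -> : z + y *i + (j%:R / n%:R)%:C = (Re z + j%:R / n%:R)%:C.
    by case: z zy => a b /= ->; simpc; rewrite addNr.
  by rewrite le_max lexx.
have yy : 0 < y < r - y by apply/andP; split=> //; lra.
have B0 : 0 <= M ^+ n * expR (n%:R * (I + d)).
  by rewrite mulr_ge0 ?exprn_ge0 ?(ltW M0)// expR_ge0.
have ImN (z : C) : Im (- z) = - Im z by case: z.
have key : cabs (G 0) * cabs (G 0) <= M ^+ n * expR (n%:R * (I + d)).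
  have Im0 : `|Im (0 : C)| <= y by rewrite /= normr0 ltW.
  have := strip_maximum_principle yy B0 hH _ Im0.
  rewrite oppr0 Normc.normcM; apply=> z /eqP.
  rewrite eqr_norml (ltW y0) andbT Normc.normcM => /orP[] /eqP zy.
    by rewrite ler_pM ?cabs_ge0 ?GM ?GI// ImN zy.
  by rewrite mulrC ler_pM ?cabs_ge0 ?GM ?GI// ImN zy opprK.
have Gm : m ^+ n <= cabs (G 0).
  rewrite cabs_prod prodE.
  apply: ler_prod => j _; rewrite (ltW m0)/= Fm//.
  by rewrite add0r /= addr0.
have mm : m ^+ n * m ^+ n <= M ^+ n * expR (n%:R * (I + d)).
  by rewrite (le_trans _ key)// ler_pM ?exprn_ge0 ?(ltW m0).
have := mm; rewrite -ler_ln ?posrE ?mulr_gt0 ?exprn_gt0 ?expR_gt0//.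
rewrite -exprD lnXn// [X in _ <= X]lnM ?posrE ?exprn_gt0 ?expR_gt0//.
rewrite expRK lnXn// -[_ *+ (n + n)]mulr_natl -[_ *+ n]mulr_natl natrD.
move=> h; rewrite -(ler_pM2l nR) mulrBr lerBlDl; apply: le_trans h.
by rewrite mulrA mulrDr mulr1.
Qed.

End LogIntegral.

(** * Integrals over the circle and almost everywhere relations *)

Section AlmostEverywhere.
Context {R : realType}.
Local Notation mu := (@lebesgue_measure R).
Local Notation D := (`[0, 1]%classic : set R).
Local Notation cint f := (\int[mu]_(x in D) f x).
Local Notation cintegrable f := (mu.-integrable D (EFin \o f)).

Lemma ae_imply (P Q : R -> Prop) : (forall x, P x -> Q x) ->
  (\forall x \ae mu, P x) -> \forall x \ae mu, Q x.
Proof.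
by move=> PQ; apply: negligibleS => x; apply: contra_not; exact: PQ.
Qed.

Lemma ae_and (P Q : R -> Prop) : (\forall x \ae mu, P x) ->
  (\forall x \ae mu, Q x) -> \forall x \ae mu, P x /\ Q x.
Proof.
move=> hP hQ; apply: negligibleS (negligibleU hP hQ) => x /not_andP[].
  by left.
by right.
Qed.

Lemma ae_forall_nat (P : nat -> R -> Prop) :
  (forall k, \forall x \ae mu, P k x) -> \forall x \ae mu, forall k, P k x.
Proof.
move=> hP; apply: negligibleS (negligible_bigcup hP) => x /= /existsNP[k Pk].
by exists k.
Qed.

Lemma circle_integrable_le (f g : R -> R) : measurable_fun setT f ->
    cintegrable g -> (forall x, `|f x| <= g x) -> cintegrable f.
Proof.
move=> mf ig fg; apply: (le_integrable _ _ _ ig) => //.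
  exact/measurable_EFinP/measurable_funTS.
by move=> x _ /=; rewrite lee_fin (le_trans (fg x))// ler_norm.
Qed.

Lemma ae_eq_circle_integral_EFin (f g : R -> R) :
    measurable_fun setT f -> measurable_fun setT g ->
    (\forall x \ae mu, D x -> f x = g x) ->
  (\int[mu]_(x in D) (f x)%:E = \int[mu]_(x in D) (g x)%:E)%E.
Proof.
move=> mf mg fg.
apply: ae_eq_integral => //; try exact/measurable_EFinP/measurable_funTS.
by apply: ae_imply fg => x fg /fg ->.
Qed.

Lemma ae_eq_circle_integral (f g : R -> R) :
    measurable_fun setT f -> measurable_fun setT g ->
    (\forall x \ae mu, D x -> f x = g x) -> cint f = cint g.
Proof.
by move=> mf mg fg; rewrite /Rintegral (ae_eq_circle_integral_EFin mf mg fg).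
Qed.

Lemma ae_le_circle_integral (f g : R -> R) :
    measurable_fun setT f -> measurable_fun setT g ->
    cintegrable f -> cintegrable g ->
    (\forall x \ae mu, D x -> f x <= g x) -> cint f <= cint g.
Proof.
move=> mf mg fi gi fg.
rewrite (@ae_eq_circle_integral f (fun x => Num.min (f x) (g x)))//.
- apply: le_Rintegral => //; last by move=> x _; rewrite ge_min lexx orbT.
  apply: (@circle_integrable_le _ (fun x => `|f x| + `|g x|)).
  + exact: measurable_minr.
  + exact: (integrableD _ (integrable_norm fi) (integrable_norm gi)).
  + by move=> x; rewrite /Num.min; case: ifP => _; rewrite ?lerDl ?lerDr.
- exact: measurable_minr.
- by apply: ae_imply fg => x fg /fg/min_idPl ->.
Qed.

Lemma ae_circle_integrable_le (f g : R -> R) :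
    measurable_fun setT f -> measurable_fun setT g -> cintegrable g ->
    (\forall x \ae mu, D x -> `|f x| <= g x) -> cintegrable f.
Proof.
move=> mf mg gi fg; apply/integrableP; split.
  exact/measurable_EFinP/measurable_funTS.
have mm : measurable_fun setT (fun x => Num.min `|f x| `|g x|).
  by apply: measurable_minr; exact: measurableT_comp.
rewrite (@ae_eq_integral _ _ _ mu D (fun x => (Num.min `|f x| `|g x|)%:E))//.
- have : cintegrable (fun x => Num.min `|f x| `|g x|).
    apply: (circle_integrable_le mm (integrable_norm gi)) => x.
    by rewrite ger0_norm ?ge_min ?lexx ?orbT// le_min !normr_ge0.
  move=> /integrableP[_]; apply: le_lt_trans; rewrite le_eqVlt.
  apply/orP; left; apply/eqP; apply: eq_integral => x _ /=.
  by rewrite [in RHS]ger0_norm// le_min !normr_ge0.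
- by apply/measurable_EFinP/measurable_funTS; exact: measurableT_comp.
- exact/measurable_EFinP/measurable_funTS.
- apply: ae_imply fg => x fg Dx /=; congr EFin; apply/esym/min_idPl.
  by rewrite (le_trans (fg Dx))// ler_norm.
Qed.

End AlmostEverywhere.

(** * Integrability of log |F| on the circle *)

Section LogModulus.
Context {R : realType}.
Local Notation C := R[i].
Local Notation mu := (@lebesgue_measure R).
Local Notation D := (`[0, 1]%classic : set R).
Local Notation cint f := (\int[mu]_(x in D) f x).
Local Notation cintegrable f := (mu.-integrable D (EFin \o f)).

(** The lower bound for the truncated logarithms does not depend on the
truncation level, so monotone convergence passes it to the limit.  As ln 0 = 0,
log |F| says nothing at the zeros of F; the monotone limit G is infinite
there, and its integrability shows that they form a null set. *)
Lemma ln_cabs_integrable (r y m M : R) (F : C -> C) :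
    strip_holomorphic r F -> 0 < y -> 2 * y < r -> 0 < m -> 0 < M ->
    (forall z, Im z = y -> m <= cabs (F z)) ->
    (forall z, Im z = 2 * y -> cabs (F z) <= M) ->
  [/\ \forall x \ae mu, D x -> F x%:C != 0,
      cintegrable (fun x => ln (cabs (F x%:C))) &
      2 * ln m - ln M <= cint (fun x => ln (cabs (F x%:C)))].
Proof.
move=> hF y0 yr m0 M0 Fm FM.
have r0 : 0 < r by rewrite (lt_trans _ yr)// mulr_gt0.
have cF := strip_real_continuous r0 hF.
have [s /andP[s0 _] [B B0 FB]] := strip_bounded r0 hF.
have {}FB (x : R) : cabs (F x%:C) <= B by rewrite FB//= normr0 ltW.
pose L := ln (Num.max B 1).
have L0 : 0 <= L by rewrite ln_ge0// le_max lexx orbT.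
pose eps (j : nat) : R := expR (- j%:R).
have eps0 j : 0 < eps j by exact: expR_gt0.
have eps1 j : eps j <= 1 by rewrite -expR0 ler_expR oppr_le0 ler0n.
pose u j (x : R) : R := ln (Num.max (cabs (F x%:C)) (eps j)).
have max0 j (x : R) : 0 < Num.max (cabs (F x%:C)) (eps j).
  by rewrite lt_max eps0 orbT.
have uL j x : u j x <= L.
  by rewrite ler_ln ?posrE// ?lt_max ?ltr01 ?orbT// ge_max !le_max FB eps1 orbT.
pose w j (x : R) : \bar R := (L - u j x)%:E.
have cw j : continuous (fun x => L - u j x).
  move=> x; apply: cvgB; first exact: cvg_cst.
  exact: (continuous_ln_max (eps0 j) cF).
have mw j : measurable_fun D (w j).
  apply/measurable_EFinP; apply: measurable_funTS.
  exact: (continuous_measurable_fun (cw j)).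
have w0 j x : D x -> (0 <= w j x)%E by rewrite lee_fin subr_ge0.
have wnd x : D x -> {homo w ^~ x : n k / (n <= k)%N >-> (n <= k)%E}.
  move=> _ j k jk; rewrite lee_fin lerD2l lerN2 ler_ln ?posrE//.
  by rewrite ge_max !le_max lexx/= ler_expR lerN2 ler_nat jk orbT.
pose G (x : R) : \bar R := limn (w ^~ x).
have mD : measurable D by exact: measurable_itv.
have wG j x : D x -> (w j x <= G x)%E.
  move=> Dx; rewrite /G (cvg_lim _ (ereal_nondecreasing_cvgn (wnd x Dx)))//.
  by apply: ereal_sup_ubound; exists j.
have mG : measurable_fun D G.
  apply: (@emeasurable_fun_cvg _ _ _ D w G mw) => x Dx.
  exact: ereal_nondecreasing_is_cvgn (wnd x Dx).
have iw j : cintegrable (fun x => L - u j x) by exact: circle_integrable_continuous.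
have Iu j : 2 * ln m - ln M <= cint (u j).
  exact: mean_ln_max_lower_bound hF y0 yr m0 M0 (eps0 j) Fm FM.
have icst (c : R) : cintegrable (fun=> c).
  by apply: circle_integrable_continuous; exact: cst_continuous.
have iu j : cintegrable (u j).
  apply: circle_integrable_continuous; exact: continuous_ln_max.
pose c := L - (2 * ln m - ln M).
have Iw j : (\int[mu]_(x in D) w j x <= c%:E)%E.
  rewrite -(fineK (integrable_fin_num _ (iw j)))// lee_fin.
  rewrite -[fine _]/(cint (fun x => L - u j x)) RintegralB//.
  by rewrite circle_integral_cst /c lerD2l lerN2.
have IG : (\int[mu]_(x in D) G x <= c%:E)%E.
  rewrite (monotone_convergence mu mD mw w0 wnd); apply: lime_le.
    apply: ereal_nondecreasing_is_cvgn => j k jk.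
    exact: (ge0_le_integral mu mD (w0 j) (mw j) (mw k) (fun x Dx => wnd x Dx j k jk)).
  by apply: nearW => j; exact: Iw.
have G0 x : D x -> (0 <= G x)%E by move=> Dx; exact: le_trans (w0 0%N x Dx) (wG _ _ Dx).
have iG : mu.-integrable D G.
  apply/integrableP; split=> //.
  have -> : (\int[mu]_(x in D) `|G x| = \int[mu]_(x in D) G x)%E.
    by apply: eq_integral => x; rewrite inE => /G0/gee0_abs ->.
  by rewrite (le_lt_trans IG) ?ltry.
pose f (x : R) : R := L - ln (cabs (F x%:C)).
have mf : measurable_fun setT f.
  apply: measurable_funB => //; apply: measurableT_comp.
    exact: measurable_ln.
  exact: continuous_measurable_fun.
have f0 x : 0 <= f x.
  rewrite subr_ge0; have [->|F0] := eqVneq (cabs (F x%:C)) 0.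
    by rewrite ln0.
  have Fp : 0 < cabs (F x%:C) by rewrite lt_neqAle eq_sym F0 cabs_ge0.
  by rewrite ler_ln ?posrE ?lt_max ?ltr01 ?orbT// le_max FB.
have u_small j x : cabs (F x%:C) <= eps j -> u j x = - j%:R.
  by move=> h; rewrite /u (max_idPr h) expRK.
have fG x : D x -> ((f x)%:E <= G x)%E.
  move=> Dx; have [F0|F0] := eqVneq (cabs (F x%:C)) 0.
    apply: le_trans (wG 0%N x Dx); rewrite lee_fin lerD2l lerN2.
    by rewrite u_small ?F0 ?ln0 ?oppr0// ltW.
  have Fp : 0 < cabs (F x%:C) by rewrite lt_neqAle eq_sym F0 cabs_ge0.
  pose j := (Num.truncn `|ln (cabs (F x%:C))|).+1.
  apply: le_trans (wG j x Dx); rewrite lee_fin lerD2l lerN2 /u.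
  suff /max_idPl -> : eps j <= cabs (F x%:C) by [].
  rewrite -[leRHS]lnK ?posrE// ler_expR lerNl.
  rewrite (le_trans (ler_norm _))// normrN.
  by rewrite ltW// truncnS_gt.
have ifL : cintegrable f.
  apply: (@le_integrable _ _ _ mu D mD (EFin \o f) G _ _ iG).
    exact/measurable_EFinP/measurable_funTS.
  move=> x Dx /=; rewrite ger0_norm// (gee0_abs (G0 x Dx)).
  exact: fG.
have E : (fun x => ln (cabs (F x%:C))) = (fun x => L - f x).
  by apply/funext => x; rewrite /f opprB addrC subrK.
split.
- have finG : \forall x \ae mu, D x -> G x \is a fin_num by exact: integrable_ae.
  apply: ae_imply finG => x hG Dx; apply/eqP => Fx0.
  have := hG Dx; rewrite fin_numE => /andP[_ /eqP]; apply.
  apply/eqyP => A A0.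
  pose j := (Num.truncn A).+1.
  apply: le_trans (wG j x Dx); rewrite lee_fin.
  rewrite u_small ?Fx0 ?Normc.normc0 ?(ltW (eps0 _))// opprK.
  apply: le_trans (lerD L0 (lexx _)).
  by rewrite add0r ltW// truncnS_gt.
- rewrite E; exact: (circle_integrableB (icst L) ifL).
- rewrite E RintegralB// circle_integral_cst lerBrDr -lerBrDl.
  have -> : L - (2 * ln m - ln M) = fine c%:E by [].
  rewrite fine_le ?integrable_fin_num//.
  by apply: le_trans IG; apply: ge0_le_integral => //;
    [move=> x _; rewrite lee_fin|exact/measurable_EFinP/measurable_funTS].
Qed.

End LogModulus.

(** * Horizontal lines on which a holomorphic function avoids a value *)

Section ZeroFreeLines.
Context {R : realType}.
Local Notation C := R[i].

(** Vanishing spreads along the real axis in steps of r / 8, each disc sharing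
an interval with the next one. *)
Lemma strip_real_eq0 (r x0 : R) (V : C -> C) : 0 < r -> strip_holomorphic r V ->
    (forall t : R, `|t - x0| <= r / 4 -> V t%:C = 0) ->
  forall t : R, V t%:C = 0.
Proof.
move=> r0 [_ h] V0; pose s := r / 8; have s0 : 0 < s by rewrite divr_gt0.
pose Z x := forall t : R, `|t - x| <= r / 4 -> V t%:C = 0.
have step x x' : `|x' - x| <= s -> Z x -> Z x'.
  move=> xx' Zx t tx'.
  apply: (disc_algebra_real_unique r0 (h x') (disc_algebra_cst _ _ 0) s0 (x1 := x')).
  - by rewrite subrr normr0 add0r /s; lra.
  - move=> q qx'; apply: Zx; have := ler_distD x' q x.
    by rewrite /s in qx' xx' *; lra.
  - by rewrite -rmorphB cabs_real.
have pos (n : nat) : Z (x0 + n%:R * s) /\ Z (x0 - n%:R * s).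
  elim: n => [|n [IH1 IH2]]; first by rewrite mul0r subr0 addr0.
  split; [apply: step IH1|apply: step IH2].
    have -> : x0 + n.+1%:R * s - (x0 + n%:R * s) = s by rewrite mulrSr; ring.
    by rewrite gtr0_norm.
  have -> : x0 - n.+1%:R * s - (x0 - n%:R * s) = - s by rewrite mulrSr; ring.
  by rewrite normrN gtr0_norm.
move=> t; pose n := Num.truncn (`|t - x0| / s).
have n1 : n%:R * s <= `|t - x0|.
  by rewrite -ler_pdivlMr// truncn_le// divr_ge0// ltW.
have n2 : `|t - x0| < (n%:R + 1) * s.
  by rewrite -ltr_pdivrMr// -mulrSr truncnS_gt.
have [Zp Zn] := pos n; rewrite mulrDl mul1r in n2.
case: (leP 0 (t - x0)) => tx.
  apply: Zp; rewrite ger0_norm// in n1 n2.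
  by rewrite ler_norml /s in n1 n2 *; lra.
apply: Zn; rewrite ltr0_norm// in n1 n2.
by rewrite ler_norml /s in n1 n2 *; lra.
Qed.

(** Near a real point the non-real zeros cannot accumulate, by the identity
theorem; compactness of the circle then makes all low enough horizontal lines
free of zeros. *)
Lemma strip_zero_free_line (r s : R) (V : C -> C) : 0 < r -> 0 < s ->
    strip_holomorphic r V -> (exists x : R, V x%:C <> 0) ->
  exists2 y : R, 0 < y < s & exists2 d : R, 0 < d &
    forall z, Im z = y -> d <= cabs (V z).
Proof.
move=> r0 s0 hV [xV VxV]; have [_ h] := hV.
pose free (e x : R) := forall z : C,
  `|Re z - x| <= e -> 0 < Im z <= e -> V z <> 0.
have [||e e0 He] := @segment_uniform_scale R free 0 1.
- move=> e x e' x' Fx xx' z zx' /andP[z0 ze']; apply: Fx.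
    by have := ler_distD x' (Re z) x; lra.
  by rewrite z0 (le_trans ze')// (le_trans _ xx')// lerDr.
- move=> x _; apply: contrapT => /forall2NP nfree.
  have zero (e : R) : 0 < e ->
      exists z : C, [/\ `|Re z - x| <= e, 0 < Im z, Im z <= e & V z = 0].
    move=> e0; have [//|] := nfree e; rewrite /free -existsNP => -[z].
    move=> /not_implyP[ze] /not_implyP[/andP[z0 zi]] /contrapT Vz.
    by exists z.
  apply: VxV; apply: (strip_real_eq0 (x0 := x) r0 hV) => t tx.
  have := disc_algebra_eq0 r0 (h x) _ (z := t%:C); apply; last first.
    by rewrite -rmorphB cabs_real.
  move=> k.
  (* Zeros are collected at ever smaller heights, so they are distinct. *)
  suff [l [ul lk [e [e0 le]]] Hl] : exists2 l : seq C,
      [/\ uniq l, size l = k & exists e : R, 0 < e /\ forall z, z \in l -> e < Im z]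
      & forall z, z \in l -> cabs (z - x%:C) <= r / 4 /\ V z = 0.
    by exists l.
  elim: k => [|k [l [ul lk [e [e0 le]]] Hl]].
    by exists [::] => //; split=> //; exists 1.
  pose e' := Num.min e (r / 8).
  have e'0 : 0 < e' by rewrite lt_min e0 divr_gt0.
  have [z [zx zi]] := zero e' e'0.
  rewrite {1}/e' le_min => /andP[zie zir] Vz.
  exists (z :: l).
    split; rewrite /= ?lk// ?ul ?andbT.
      by apply/negP => /le; rewrite ltNge zie.
    exists (Im z / 2); split; first by rewrite divr_gt0.
    move=> w; rewrite inE => /orP[/eqP->|/le].
      by rewrite ltr_pdivrMr// mulrDr mulr1 ltrDl.
    by lra.
  move=> w; rewrite inE => /orP[/eqP->|/Hl//]; split=> //.
  rewrite (le_trans (cabsB_trans (Re z)%:C _ _))// cabs_sub_Re -rmorphB cabs_real.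
  have : e' <= r / 8 by rewrite ge_min lexx orbT.
  by rewrite (gtr0_norm zi); lra.
pose y := Num.min (Num.min e (s / 2)) (r / 2).
have y0 : 0 < y by rewrite !lt_min e0 !divr_gt0.
have ye : y <= e by rewrite !ge_min lexx.
have ys : y <= s / 2 by rewrite !ge_min lexx orbT.
have yr : y <= r / 2 by rewrite ge_min lexx orbT.
exists y; first by rewrite y0/=; lra.
have yr' : `|y| < r by rewrite gtr0_norm//; lra.
have cV : continuous (fun t : R => cabs (V (t%:C + y *i))).
  apply: (strip_real_continuous _ (strip_vertical_shift y hV)).
  by rewrite subr_gt0.
have [c c01 cmin] := EVT_min ler01 (continuous_subspaceT cV).
exists (cabs (V (c%:C + y *i))).
  rewrite cabs_gt0; apply/eqP; apply: (He c) => //=.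
    by rewrite addr0 subrr normr0 ltW.
  by rewrite add0r y0.
move=> z zy; pose m := Num.floor (Re z).
have -> : V z = V ((Re z - m%:~R)%:C + y *i).
  rewrite -(strip_periodic (- m) z hV) mulrNz.
  by congr V; case: z zy @m => a b /= ->; simpc.
apply: cmin; rewrite in_itv /=.
by have /andP[] := floor_itv (Re z); rewrite intrD1 -/m; lra.
Qed.

(** A line that avoids a value E at distance d avoids the values near E at a
slightly smaller distance, so compactness of the segment gives a d that serves
all values; the line itself depends on the value. *)
Lemma strip_value_free_lines (r s a b : R) (V : C -> C) : 0 < r -> 0 < s ->
    strip_holomorphic r V -> (exists x x' : R, V x%:C <> V x'%:C) ->
  exists2 d : R, 0 < d & forall E : R, a <= E <= b ->
    exists2 y : R, 0 < y < s & forall z, Im z = y -> d <= cabs (V z - E%:C).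
Proof.
move=> r0 s0 hV [x [x' xx']].
apply: (@segment_uniform_scale R (fun d E => exists2 y : R, 0 < y < s &
  forall z, Im z = y -> d <= cabs (V z - E%:C))).
  move=> d E d' E' [y ys Vy] EE'; exists y => // z /Vy.
  have := cabsB_trans E'%:C (V z) E%:C; rewrite -rmorphB cabs_real; lra.
move=> E _; have hE := stripD hV (strip_cst r (- E%:C)).
have nz : exists t : R, V t%:C - E%:C <> 0.
  case: (eqVneq (V x%:C) E%:C) => [xE|/eqP xE].
    exists x' => /eqP; rewrite subr_eq0 => /eqP x'E; apply: xx'.
    by rewrite xE x'E.
  by exists x => /eqP; rewrite subr_eq0 => /eqP.
have [y ys [d d0 Vd]] := strip_zero_free_line r0 s0 hE nz.
by exists d => //; exists y.
Qed.

End ZeroFreeLines.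

(** * The operator norm *)

Section OperatorNorm.
Context {R : realType} {n : nat}.
Local Notation C := R[i].
Implicit Types (A B : 'M[C]_n).

Lemma l2norm_ge0 (x : 'cV[C]_n) : 0 <= l2norm x.
Proof. exact: sqrtr_ge0. Qed.

Lemma sqr_l2norm (x : 'cV[C]_n) : l2norm x ^+ 2 = \sum_i cabs (x i 0) ^+ 2.
Proof. by rewrite sqr_sqrtr// sumr_ge0// => i _; exact: sqr_ge0. Qed.

Lemma cabs_le_l2norm (x : 'cV[C]_n) i : cabs (x i 0) <= l2norm x.
Proof.
rewrite -(ler_pXn2r (n := 2))// ?nnegrE ?cabs_ge0 ?l2norm_ge0// sqr_l2norm.
by rewrite (bigD1 i)//= lerDl sumr_ge0// => j _; exact: sqr_ge0.
Qed.

Lemma l2norm_le_sum (x : 'cV[C]_n) : l2norm x <= \sum_i cabs (x i 0).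
Proof.
have s0 : 0 <= \sum_i cabs (x i 0) by apply: sumr_ge0 => i _; exact: cabs_ge0.
rewrite -(ler_pXn2r (n := 2))// ?nnegrE ?l2norm_ge0// sqr_l2norm.
rewrite [leRHS]expr2 mulr_suml ler_sum// => i _; rewrite expr2.
rewrite ler_wpM2l ?cabs_ge0// (bigD1 i)//= lerDl sumr_ge0// => j _.
exact: cabs_ge0.
Qed.

Lemma l2norm0 : l2norm (0 : 'cV[C]_n) = 0.
Proof.
rewrite /l2norm big1 ?sqrtr0// => i _.
by rewrite mxE Normc.normc0 expr0n.
Qed.

Lemma l2norm_eq0 (x : 'cV[C]_n) : (l2norm x == 0) = (x == 0).
Proof.
apply/eqP/eqP => [x0|->]; last exact: l2norm0.
apply/matrixP => i j; rewrite ord1 mxE; apply/eqP.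
by rewrite -cabs_eq0 eq_le cabs_ge0 andbT -x0 cabs_le_l2norm.
Qed.

Lemma l2normZ (c : C) (x : 'cV[C]_n) : l2norm (c *: x) = cabs c * l2norm x.
Proof.
apply/eqP; rewrite -(eqrXn2 (n := 2))// ?mulr_ge0 ?cabs_ge0 ?l2norm_ge0//.
rewrite exprMn !sqr_l2norm mulr_sumr; apply/eqP; apply: eq_bigr => i _.
by rewrite mxE Normc.normcM exprMn.
Qed.

Lemma l2normD (x y : 'cV[C]_n) : l2norm (x + y) <= l2norm x + l2norm y.
Proof.
have [->|x0] := eqVneq x 0; first by rewrite l2norm0 !add0r.
have [->|y0] := eqVneq y 0; first by rewrite l2norm0 !addr0.
have X0 : 0 < l2norm x by rewrite lt_neqAle eq_sym l2norm_eq0 x0 l2norm_ge0.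
have Y0 : 0 < l2norm y by rewrite lt_neqAle eq_sym l2norm_eq0 y0 l2norm_ge0.
set X := l2norm x in X0 *; set Y := l2norm y in Y0 *.
have CS : \sum_i cabs (x i 0) * cabs (y i 0) <= X * Y.
  have : 0 <= \sum_i (Y * cabs (x i 0) - X * cabs (y i 0)) ^+ 2.
    by apply: sumr_ge0 => i _; exact: sqr_ge0.
  have E i : (Y * cabs (x i 0) - X * cabs (y i 0)) ^+ 2 =
      Y ^+ 2 * cabs (x i 0) ^+ 2 + X ^+ 2 * cabs (y i 0) ^+ 2
      - 2 * X * Y * (cabs (x i 0) * cabs (y i 0)) by ring.
  under eq_bigr do rewrite E.
  rewrite sumrB big_split /= -!mulr_sumr -!sqr_l2norm -/X -/Y.
  set S := \sum_(_ < _) _; rewrite subr_ge0.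
  have -> : Y ^+ 2 * X ^+ 2 + X ^+ 2 * Y ^+ 2 = 2 * X * Y * (X * Y) by ring.
  by rewrite ler_pM2l// !mulr_gt0.
rewrite -(ler_pXn2r (n := 2))// ?nnegrE ?addr_ge0 ?l2norm_ge0//.
rewrite sqr_l2norm sqrrD !sqr_l2norm.
rewrite (@le_trans _ _ (\sum_i (cabs (x i 0) ^+ 2 + cabs (y i 0) ^+ 2 +
    2 * (cabs (x i 0) * cabs (y i 0)))))//.
  apply: ler_sum => i _; rewrite mxE.
  have -> : cabs (x i 0) ^+ 2 + cabs (y i 0) ^+ 2 +
    2 * (cabs (x i 0) * cabs (y i 0)) = (cabs (x i 0) + cabs (y i 0)) ^+ 2 by ring.
  by rewrite lerXn2r ?nnegrE ?addr_ge0 ?cabs_ge0// cabsD.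
by rewrite !big_split /= -mulr_sumr mulr2n; lra.
Qed.

(** A crude majorant of the operator norm, through which continuity of the norm
is reduced to that of the entries. *)
Definition entry_sum A : R := \sum_i \sum_j cabs (A i j).

Lemma l2norm_mulmx_le_entry_sum A (x : 'cV[C]_n) : l2norm (A *m x) <= entry_sum A * l2norm x.
Proof.
rewrite (le_trans (l2norm_le_sum _))// mulr_suml ler_sum// => i _.
rewrite mxE (le_trans (cabs_sum _ _))// mulr_suml ler_sum// => j _.
by rewrite Normc.normcM ler_wpM2l ?cabs_ge0 ?cabs_le_l2norm.
Qed.

Lemma entry_sum_ge0 A : 0 <= entry_sum A.
Proof. by apply: sumr_ge0 => i _; apply: sumr_ge0 => j _; exact: cabs_ge0. Qed.

Let unit_images A : set R := [set l2norm (A *m x) | x in [set x : 'cV[C]_n | l2norm x <= 1]].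

Let unit_images_ub A : ubound (unit_images A) (entry_sum A).
Proof.
move=> _ [x x1 <-]; rewrite (le_trans (l2norm_mulmx_le_entry_sum _ _))//.
by rewrite ler_piMr ?entry_sum_ge0.
Qed.

Let unit_images_has_sup A : has_sup (unit_images A).
Proof.
split; last by exists (entry_sum A); exact: unit_images_ub.
by exists (l2norm (A *m 0)); exists 0; rewrite //= l2norm0 ler01.
Qed.

Lemma opnorm_ub A (x : 'cV[C]_n) : l2norm x <= 1 -> l2norm (A *m x) <= opnorm A.
Proof.
by move=> x1; apply: sup_upper_bound; [exact: unit_images_has_sup|exists x].
Qed.

Lemma opnorm_le A (c : R) :
  (forall x : 'cV[C]_n, l2norm x <= 1 -> l2norm (A *m x) <= c) -> opnorm A <= c.
Proof.
move=> h; apply: ge_sup => [|_ [x x1 <-]]; last exact: h.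
by have [] := unit_images_has_sup A.
Qed.

Lemma opnorm_ge0 A : 0 <= opnorm A.
Proof.
by rewrite -l2norm0 -(mulmx0 _ A) opnorm_ub// l2norm0 ler01.
Qed.

Lemma opnorm_le_entry_sum A : opnorm A <= entry_sum A.
Proof.
apply: opnorm_le => x x1; rewrite (le_trans (l2norm_mulmx_le_entry_sum _ _))//.
by rewrite ler_piMr ?entry_sum_ge0.
Qed.

Lemma l2norm_mulmx_le A (x : 'cV[C]_n) : l2norm (A *m x) <= opnorm A * l2norm x.
Proof.
have [->|x0] := eqVneq x 0; first by rewrite mulmx0 l2norm0 mulr0.
have X0 : 0 < l2norm x by rewrite lt_neqAle eq_sym l2norm_eq0 x0 l2norm_ge0.
have iX : cabs ((l2norm x)^-1)%:C = (l2norm x)^-1.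
  by rewrite cabs_real_ge0// invr_ge0 ltW.
have := @opnorm_ub A (((l2norm x)^-1)%:C *: x).
rewrite -scalemxAr !l2normZ iX mulVf ?gt_eqF// => /(_ (lexx _)).
by rewrite mulrC ler_pdivrMr.
Qed.

Lemma opnormM A B : opnorm (A *m B) <= opnorm A * opnorm B.
Proof.
apply: opnorm_le => x x1; rewrite -mulmxA (le_trans (l2norm_mulmx_le _ _))//.
by rewrite ler_wpM2l ?opnorm_ge0// opnorm_ub.
Qed.

Lemma opnormZ_le (c : C) A : opnorm (c *: A) <= cabs c * opnorm A.
Proof.
apply: opnorm_le => x x1; rewrite -scalemxAl l2normZ ler_wpM2l ?cabs_ge0//.
exact: opnorm_ub.
Qed.

Lemma opnormZ (c : C) A : opnorm (c *: A) = cabs c * opnorm A.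
Proof.
apply/eqP; rewrite eq_le opnormZ_le/=.
have [->|c0] := eqVneq c 0; first by rewrite Normc.normc0 mul0r opnorm_ge0.
have := opnormZ_le c^-1 (c *: A).
rewrite scalerA mulVf// scale1r Normc.normcV mulrC.
by rewrite ler_pdivlMr ?cabs_gt0// mulrC.
Qed.

Lemma opnormD A B : opnorm (A + B) <= opnorm A + opnorm B.
Proof.
apply: opnorm_le => x x1; rewrite mulmxDl (le_trans (l2normD _ _))//.
by rewrite lerD// opnorm_ub.
Qed.

Lemma cabs_entry_le_opnorm A i j : cabs (A i j) <= opnorm A.
Proof.
have e1 : l2norm (delta_mx j 0 : 'cV[C]_n) <= 1.
  rewrite /l2norm (bigD1 j)//= big1 => [|k kj].
    by rewrite mxE !eqxx Normc.normc1 expr1n addr0 sqrtr1.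
  by rewrite mxE (negbTE kj) Normc.normc0 expr0n.
apply: le_trans (opnorm_ub A e1).
have := cabs_le_l2norm (A *m delta_mx j 0) i.
by rewrite -colE mxE.
Qed.

Lemma opnorm_dist A B : `|opnorm A - opnorm B| <= entry_sum (A - B).
Proof.
have h A' B' : opnorm A' - opnorm B' <= entry_sum (A' - B').
  rewrite lerBlDr (le_trans _ (lerD (opnorm_le_entry_sum _) (lexx _)))//.
  by rewrite (le_trans _ (opnormD _ _))// subrK.
have sym : entry_sum (A - B) = entry_sum (B - A).
  apply: eq_bigr => i _; apply: eq_bigr => j _; rewrite !mxE.
  by rewrite cabsC.
by rewrite ler_norml h andbT lerNl opprB sym h.
Qed.

Lemma continuous_opnorm (F : R -> 'M[C]_n) :
    (forall i j (x e : R), 0 < e -> \forall y \near x, cabs (F x i j - F (y : R) i j) < e) ->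
  continuous (fun x : R => opnorm (F x)).
Proof.
move=> cF x; apply/cvgrPdist_le => e e0.
pose N : R := (n * n)%:R + 1.
have N0 : 0 < N by rewrite ltr_wpDl.
have eN : 0 < e / N by rewrite divr_gt0.
have near_all : \forall y \near x, forall i j, cabs (F x i j - F y i j) < e / N.
  apply: (filter_forall (nbhs_filter (x : R))) => i.
  by apply: (filter_forall (nbhs_filter (x : R))) => j; exact: cF.
apply: filterS near_all => y Fy.
rewrite (le_trans (opnorm_dist _ _))//.
rewrite (@le_trans _ _ (\sum_(i < n) \sum_(j < n) (e / N)))//.
  apply: ler_sum => i _; apply: ler_sum => j _; rewrite !mxE.
  exact: ltW.
rewrite !sumr_const !card_ord -mulrnA -mulr_natl mulrCA.
rewrite ler_piMr ?(ltW e0)// ler_pdivrMr// mul1r.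
by rewrite lerDl.
Qed.

End OperatorNorm.

(** * Subadditive sequences *)

Section Fekete.
Context {R : realType}.

(** Fekete's lemma: the limit is the infimum of the b n / n, which therefore
inherits the lower bound. *)
Lemma subadditive_cvg (b : nat -> R) (l0 : R) :
    (forall n m, b (n + m)%N <= b n + b m) -> (forall n, n%:R * l0 <= b n) ->
  exists2 l, l0 <= l & (b n / n%:R) @[n --> \oo] --> l.
Proof.
move=> sub lb; pose S := [set b n.+1 / n.+1%:R | n in setT].
have Slb : lbound S l0.
  by move=> _ [n _ <-]; rewrite ler_pdivlMr ?ltr0Sn// mulrC lb.
have S0 : S !=set0 by exists (b 1 / 1%:R); exists 0%N.
have Sinf : has_inf S by split=> //; exists l0.
exists (inf S); first exact: lb_le_inf.
set l := inf S; apply/cvgrPdist_le => e e0.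
have e2 : 0 < e / 2 by rewrite divr_gt0.
have [_ [m' _ <-]] := inf_adherent e2 Sinf; rewrite -/l.
set m := m'.+1 => mlt; have m0 : (0 : R) < m%:R by rewrite ltr0Sn.
pose B : R := \sum_(r < m) `|b r|.
have bB r : (r < m)%N -> b r <= B.
  move=> rm; rewrite /B (bigD1 (Ordinal rm))//= (le_trans (ler_norm _))//.
  by rewrite lerDl sumr_ge0.
have bq q r : b (q * m + r)%N <= q%:R * b m + b r.
  elim: q => [|q IH]; first by rewrite mul0r add0r.
  rewrite mulSn -addnA (le_trans (sub _ _))// mulrSr mulrDl mul1r.
  by rewrite addrC -addrA [b m + _]addrC addrA lerD2r.
pose K : R := m%:R * `|l + e / 2| + B.
pose N := (Num.truncn (K / (e / 2))).+1.
exists N => // n /= Nn.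
have n0 : (0 : R) < n%:R by rewrite ltr0n (leq_trans _ Nn).
have KN : K <= n%:R * (e / 2).
  rewrite -ler_pdivrMr// ltW// (lt_le_trans (truncnS_gt _))//.
  by rewrite ler_nat.
have ln : l <= b n / n%:R.
  apply: ge_inf; first by exists l0.
  by exists n.-1 => //; rewrite prednK// (leq_trans _ Nn).
rewrite distrC ger0_norm ?subr_ge0// lerBlDl ler_pdivrMr//.
have nE := divn_eq n m; set q := (n %/ m)%N in nE; set r := (n %% m)%N in nE.
have rm : (r < m)%N by rewrite ltn_mod.
have h1 : b n <= q%:R * b m + B by rewrite [in b n]nE (le_trans (bq _ _))// lerD2l bB.
have h2 : b m <= m%:R * (l + e / 2) by rewrite mulrC -ler_pdivrMr// ltW.
have h3 : q%:R * b m <= q%:R * (m%:R * (l + e / 2)) by rewrite ler_wpM2l.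
have h4 : q%:R * m%:R = n%:R - r%:R :> R by rewrite nE natrD natrM addrK.
rewrite mulrA h4 in h3.
have h5 : - (r%:R * (l + e / 2)) <= m%:R * `|l + e / 2|.
  rewrite -mulrN (@le_trans _ _ (r%:R * `|l + e / 2|))//.
    by rewrite ler_wpM2l// -normrN ler_norm.
  by rewrite ler_wpM2r// ler_nat ltnW.
have : (n%:R - r%:R) * (l + e / 2) = n%:R * (l + e / 2) - r%:R * (l + e / 2).
  by rewrite mulrBl.
have : n%:R * (l + e / 2) + n%:R * (e / 2) = (l + e) * n%:R by field.
rewrite /K in KN; lra.
Qed.

End Fekete.

(** * The cocycle without denominators *)

Section Cocycle.
Context {R : realType}.
Local Notation C := R[i].
Variables (la lv E omega : R).

(** The Jacobi matrix without its scalar denominator.  The denominators commute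
with everything and are split off, since they may vanish. *)
Definition jacobi_num (a : R -> C) (v : R -> R) (x : R) : 'M[C]_2 :=
  mx22 (lv * v x - E)%:C (- (la%:C * conjc (a x))) (la%:C * a (x + omega)) 0.

Definition jacobi_num_transfer (a : R -> C) (v : R -> R) (n : nat) (x : R) :
    'M[C]_2 :=
  \prod_(k <- rev (iota 1 n)) jacobi_num a v (x + k%:R * omega).

Lemma jacobi_num_transferS a v n x : jacobi_num_transfer a v n.+1 x =
  jacobi_num a v (x + n.+1%:R * omega) * jacobi_num_transfer a v n x.
Proof.
rewrite /jacobi_num_transfer -[in iota 1 n.+1](addn1 n) iotaD add1n /=.
by rewrite rev_cat big_cat /= big_seq1.
Qed.

Lemma jacobi_num_transferD a v n m x : jacobi_num_transfer a v (n + m) x =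
  jacobi_num_transfer a v n (x + m%:R * omega) * jacobi_num_transfer a v m x.
Proof.
elim: n => [|n IH]; first by rewrite add0n /jacobi_num_transfer big_nil mul1r.
rewrite addSn !jacobi_num_transferS IH mulrA; congr (jacobi_num _ _ _ * _ * _).
by rewrite -addSn natrD; ring.
Qed.

Lemma jacobi_transferE a v n x :
  jacobi_transfer la a lv v n x E omega =
  (\prod_(k <- iota 1 n) (la%:C * a (x + k%:R * omega + omega))^-1) *:
    jacobi_num_transfer a v n x.
Proof.
rewrite /jacobi_transfer /jacobi_mx scaler_prod; congr (_ *: _).
by apply: perm_big; rewrite perm_rev.
Qed.

(** First column of the holomorphic extension of the unnormalised cocycle;
[Ac] extends the complex conjugate of [a]. *)
Fixpoint jacobi_column (V A Ac : C -> C) (n : nat) (z : C) : C * C :=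
  if n is k.+1 then
    let pq := jacobi_column V A Ac k z in
    let w := z + (k.+1%:R * omega)%:C in
    ((lv%:C * V w - E%:C) * pq.1 - la%:C * Ac w * pq.2,
     la%:C * A (w + omega%:C) * pq.1)
  else (1, 0).

Lemma jacobi_column_real (V A Ac : C -> C) a v n (x : R) :
    (forall t, V t%:C = (v t)%:C) -> (forall t, A t%:C = a t) ->
    (forall t, Ac t%:C = conjc (a t)) ->
  jacobi_column V A Ac n x%:C =
  (jacobi_num_transfer a v n x 0 0, jacobi_num_transfer a v n x 1 0).
Proof.
move=> VE AE AcE; elim: n => [|n IH].
  by rewrite /jacobi_num_transfer big_nil !mxE.
rewrite jacobi_num_transferS /= IH /= -!rmorphD VE AE AcE.
rewrite -mulmxE !mxE !big_ord_recl !big_ord0 /jacobi_num /mx22 !mxE /=.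
rewrite !addr0 mul0r addr0 mulNr rmorphB rmorphM.
by congr ((_ - _ * _) , _); congr (jacobi_num_transfer _ _ _ _ _ _); apply/val_inj.
Qed.

Lemma jacobi_column_strip (V A Ac : C -> C) (r : R) n :
    strip_holomorphic r V -> strip_holomorphic r A -> strip_holomorphic r Ac ->
  strip_holomorphic r (fun z => (jacobi_column V A Ac n z).1) /\
  strip_holomorphic r (fun z => (jacobi_column V A Ac n z).2).
Proof.
move=> hV hA hAc; elim: n => [|n [IH1 IH2]] /=.
  by split; exact: strip_cst.
have hs W t : strip_holomorphic r W -> strip_holomorphic r (fun z => W (z + t%:C)).
  exact: strip_shift.
split.
  apply: stripD.
    apply: stripM IH1; apply: stripD; last exact: strip_cst.
    by apply: stripM; [exact: strip_cst|exact: hs].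
  have := stripM (stripM (strip_cst r (- la%:C)) (hs _ (n.+1%:R * omega) hAc)) IH2.
  by under eq_fun do rewrite !mulNr.
apply: stripM IH1; apply: stripM; first exact: strip_cst.
have := hs _ (n.+1%:R * omega + omega) hA.
by under eq_fun do rewrite rmorphD addrA.
Qed.

Section ColumnBounds.
Variables (V A Ac : C -> C) (B : R).
Hypotheses (la0 : 0 < la) (lv0 : 0 < lv) (B0 : 0 < B).

(** The norm used, |p| + |q|, makes the growth of one step at most the largest
column sum of the matrix. *)
Lemma jacobi_column_le (s : R) n z :
    (forall z, `|Im z| <= s -> cabs (V z) <= B) ->
    (forall z, `|Im z| <= s -> cabs (A z) <= B) ->
    (forall z, `|Im z| <= s -> cabs (Ac z) <= B) -> `|Im z| <= s ->
  cabs (jacobi_column V A Ac n z).1 + cabs (jacobi_column V A Ac n z).2 <=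
  (lv * B + `|E| + 2 * (la * B)) ^+ n.
Proof.
move=> VB AB AcB zs.
elim: n => [|n IH].
  have -> : cabs (jacobi_column V A Ac 0 z).1 = 1 by exact: Normc.normc1.
  have -> : cabs (jacobi_column V A Ac 0 z).2 = 0 by exact: Normc.normc0.
  by rewrite addr0.
cbn [jacobi_column fst snd]; set pq := jacobi_column _ _ _ _ _ in IH *.
set w := z + _; have ws : `|Im w| <= s by rewrite Im_add_real.
have ws' : `|Im (w + omega%:C)| <= s by rewrite Im_add_real.
have T1 : cabs (lv%:C * V w - E%:C) <= lv * B + `|E|.
  rewrite (le_trans (cabsD _ _))// cabsN cabs_real lerD2r.
  by rewrite Normc.normcM cabs_real_ge0 ?(ltW lv0)// ler_pM2l// VB.
have T2 : cabs (la%:C * Ac w) <= la * B.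
  by rewrite Normc.normcM cabs_real_ge0 ?(ltW la0)// ler_pM2l// AcB.
have T3 : cabs (la%:C * A (w + omega%:C)) <= la * B.
  by rewrite Normc.normcM cabs_real_ge0 ?(ltW la0)// ler_pM2l// AB.
have p0 := cabs_ge0 pq.1; have q0 := cabs_ge0 pq.2.
have U1 := le_trans (cabsD ((lv%:C * V w - E%:C) * pq.1) (- (la%:C * Ac w * pq.2))) (lexx _).
rewrite cabsN !(Normc.normcM _ pq.1) !(Normc.normcM _ pq.2) in U1.
rewrite (Normc.normcM _ pq.1) exprS.
have W1 := ler_wpM2r p0 T1; have W2 := ler_wpM2r q0 T2; have W3 := ler_wpM2r p0 T3.
have lB0 : 0 <= la * B by rewrite ltW// mulr_gt0.
have T0 : 0 <= lv * B + `|E| + 2 * (la * B).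
  by rewrite !addr_ge0// mulr_ge0// ltW.
have W4 := ler_wpM2l T0 IH; apply: le_trans W4.
have : 0 <= (lv * B + `|E|) * cabs pq.2.
  by rewrite mulr_ge0// addr_ge0// mulr_ge0// ltW.
have := mulr_ge0 lB0 p0; have := mulr_ge0 lB0 q0.
move: W1 W2 W3; set a1 := lv * B + _; set b1 := la * B => W1 W2 W3.
have -> : (a1 + 2 * b1) * (cabs pq.1 + cabs pq.2) = a1 * cabs pq.1 +
  a1 * cabs pq.2 + 2 * (b1 * cabs pq.1) + 2 * (b1 * cabs pq.2) by ring.
lra.
Qed.

(** The cone on which the first component dominates the second one is invariant:
there the off-diagonal term costs at most half of the diagonal one, which is at
least lv d, so the first component grows by lv d / 2 at each step. *)
Lemma jacobi_column_ge (d y : R) n z :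
    (forall z, Im z = y -> cabs (A z) <= B) ->
    (forall z, Im z = y -> cabs (Ac z) <= B) ->
    (forall z, Im z = y -> lv * d <= cabs (lv%:C * V z - E%:C)) ->
    la * B <= lv * d / 2 -> Im z = y ->
  (lv * d / 2) ^+ n <= cabs (jacobi_column V A Ac n z).1 /\
  cabs (jacobi_column V A Ac n z).2 <= cabs (jacobi_column V A Ac n z).1.
Proof.
move=> AB AcB Vd lad zy.
elim: n => [|n [IH1 IH2]].
  have -> : cabs (jacobi_column V A Ac 0 z).1 = 1 by exact: Normc.normc1.
  have -> : cabs (jacobi_column V A Ac 0 z).2 = 0 by exact: Normc.normc0.
  by rewrite expr0.
cbn [jacobi_column fst snd]; set pq := jacobi_column _ _ _ _ _ in IH1 IH2 *.
set w := z + _; have wy : Im w = y by rewrite Im_add_real.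
have wy' : Im (w + omega%:C) = y by rewrite Im_add_real.
have T2 : cabs (la%:C * Ac w) <= la * B.
  by rewrite Normc.normcM cabs_real_ge0 ?(ltW la0)// ler_pM2l// AcB.
have T3 : cabs (la%:C * A (w + omega%:C)) <= la * B.
  by rewrite Normc.normcM cabs_real_ge0 ?(ltW la0)// ler_pM2l// AB.
have p0 := cabs_ge0 pq.1; have q0 := cabs_ge0 pq.2.
have lB0 : 0 < la * B by rewrite mulr_gt0.
have grow : lv * d / 2 * cabs pq.1 <=
    cabs ((lv%:C * V w - E%:C) * pq.1 - la%:C * Ac w * pq.2).
  have := cabsD ((lv%:C * V w - E%:C) * pq.1 - la%:C * Ac w * pq.2)
                (la%:C * Ac w * pq.2).
  rewrite subrK (Normc.normcM _ pq.1) (Normc.normcM _ pq.2).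
  have := ler_wpM2r p0 (Vd w wy).
  have : cabs (la%:C * Ac w) * cabs pq.2 <= lv * d / 2 * cabs pq.1.
    by rewrite ler_pM ?cabs_ge0// (le_trans T2).
  lra.
split.
  apply: le_trans grow; rewrite exprS ler_wpM2l//.
  by rewrite (le_trans _ lad)// ltW.
apply: le_trans grow; rewrite (Normc.normcM _ pq.1) ler_wpM2r//.
exact: le_trans lad.
Qed.

End ColumnBounds.
End Cocycle.

(** * Holomorphic extension of analytic functions on the circle *)

Section PowerSeries.
Context {R : realType}.
Local Notation C := R[i].

(** Existence of local expansions in terms of the real-valued modulus, a form
shared by real-valued functions, complex-valued ones and their conjugates. *)
Definition locally_power_series (f : R -> C) : Prop :=
  forall x0 : R, exists (c : nat -> C) (r : R), 0 < r /\
    forall x : R, `|x - x0| < r -> forall e : R, 0 < e ->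
      exists N, forall n, (N <= n)%N ->
        cabs (\sum_(k < n) c k * (x - x0)%:C ^+ k - f x) < e.

Lemma locally_power_series_complex (a : R -> C) :
  analytic_circle_complex a -> locally_power_series a.
Proof.
move=> [_ ha] x0; have [c [r [r0 ac]]] := ha x0.
exists c, r; split=> // x xr e e0.
have eC : 0 < e%:C by rewrite ltcR.
have [N HN] := cvg_seq_dist (ac x xr) eC; exists N => n /HN.
by rewrite /series /= big_mkord complex_normE ltcR.
Qed.

Lemma locally_power_series_real (v : R -> R) :
  analytic_circle_real v -> locally_power_series (fun x => (v x)%:C).
Proof.
move=> [_ hv] x0; have [c [r [r0 vc]]] := hv x0.
exists (fun k => (c k)%:C), r; split=> // x xr e e0.
have [N HN] := cvg_seq_dist (vc x xr) e0; exists N => n /HN.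
rewrite /series /= big_mkord => h.
under eq_bigr do rewrite -rmorphXn -rmorphM.
by rewrite -rmorph_sum -rmorphB cabs_real.
Qed.

Lemma locally_power_series_conj (a : R -> C) :
  locally_power_series a -> locally_power_series (fun x => conjc (a x)).
Proof.
move=> ha x0; have [c [r [r0 ac]]] := ha x0.
exists (fun k => conjc (c k)), r; split=> // x xr e e0.
have [N HN] := ac x xr e e0; exists N => n /HN.
rewrite -cabs_conj rmorphB rmorph_sum.
by under eq_bigr do rewrite rmorphM rmorphXn /= oppr0.
Qed.

Lemma analytic_strip_extension (f : R -> C) :
    periodic f 1 -> locally_power_series f ->
  exists2 r : R, 0 < r & exists2 V, strip_holomorphic r V &
    forall x : R, V x%:C = f x.
Proof.
move=> fp hf; apply: strip_extension => // x0.
have [c [r [r0 fc]]] := hf x0.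
exact: power_series_disc_algebra r0 fc.
Qed.

End PowerSeries.

(** * Continuity of complex-valued functions of a real variable *)

Section ComplexContinuity.
Context {R : realType}.
Local Notation C := R[i].

(** Stated with the real-valued modulus, to match the estimates for matrix
entries. *)
Definition cabs_continuous (f : R -> C) : Prop :=
  forall x e : R, 0 < e -> \forall y \near x, cabs (f x - f (y : R)) < e.

Lemma cabs_continuous_ext f g : f =1 g -> cabs_continuous f -> cabs_continuous g.
Proof. by move=> /funext ->. Qed.

Lemma cabs_continuous_cst c : cabs_continuous (fun=> c).
Proof. by move=> x e e0; near=> y; rewrite subrr Normc.normc0. Unshelve. all: by end_near. Qed.

Lemma cabs_continuousD f g : cabs_continuous f -> cabs_continuous g ->
  cabs_continuous (fun x => f x + g x).
Proof.
move=> hf hg x e e0; have e2 : 0 < e / 2 by rewrite divr_gt0.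
apply: filterS2 (hf x _ e2) (hg x _ e2) => y fy gy.
rewrite opprD addrACA (le_lt_trans (cabsD _ _))//.
by rewrite [e]splitr ltrD.
Qed.

Lemma cabs_continuousM f g : cabs_continuous f -> cabs_continuous g ->
  cabs_continuous (fun x => f x * g x).
Proof.
move=> hf hg x e e0.
pose Mf := cabs (f x) + 1; pose Mg := cabs (g x) + 1.
have Mf0 : 0 < Mf by rewrite ltr_wpDl ?cabs_ge0.
have Mg0 : 0 < Mg by rewrite ltr_wpDl ?cabs_ge0.
have ef : 0 < e / (2 * Mg) by rewrite divr_gt0 ?mulr_gt0.
have eg : 0 < Num.min 1 (e / (2 * Mf)).
  by rewrite lt_min ltr01 divr_gt0 ?mulr_gt0.
apply: filterS2 (hf x _ ef) (hg x _ eg) => y fy; rewrite lt_min => /andP[g1 gy].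
have -> : f x * g x - f y * g y = f x * (g x - g y) + (f x - f y) * g y by ring.
rewrite (le_lt_trans (cabsD _ _))// !Normc.normcM.
have gyM : cabs (g y) <= Mg.
  by have := cabsB_trans (g x) (g y) 0; rewrite !subr0 (cabsC (g y)) /Mg; lra.
have h1 : cabs (f x) * cabs (g x - g y) <= e / 2.
  rewrite (@le_trans _ _ (Mf * (e / (2 * Mf))))//.
    by rewrite ler_pM ?cabs_ge0 ?(ltW gy)// lerDl.
  by rewrite le_eqVlt; apply/orP; left; apply/eqP; field; rewrite gt_eqF.
have h2 : cabs (f x - f y) * cabs (g y) < e / 2.
  rewrite (@le_lt_trans _ _ (cabs (f x - f y) * Mg))//.
    by rewrite ler_wpM2l ?cabs_ge0.
  rewrite -ltr_pdivlMr// (lt_le_trans fy)// le_eqVlt; apply/orP; left; apply/eqP.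
  by field; rewrite gt_eqF.
lra.
Qed.

Lemma cabs_continuousN f : cabs_continuous f -> cabs_continuous (fun x => - f x).
Proof.
move=> hf x e e0; apply: filterS (hf x e e0) => y.
by rewrite -opprD cabsN.
Qed.

Lemma cabs_continuous_shift t f : cabs_continuous f ->
  cabs_continuous (fun x => f (x + t)).
Proof.
move=> hf x e e0.
have /nbhs_ballP[d /= d0 Hd] := hf (x + t) e e0.
apply/nbhs_ballP; exists d => // y; rewrite -ball_normE /= => xy.
apply: Hd; rewrite -ball_normE /=.
by rewrite opprD addrACA subrr addr0.
Qed.

Lemma cabs_continuous_conj f : cabs_continuous f ->
  cabs_continuous (fun x => conjc (f x)).
Proof.
move=> hf x e e0; apply: filterS (hf x e e0) => y.
by rewrite -rmorphB cabs_conj.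
Qed.

Lemma cabs_continuous_strip (r : R) V : 0 < r -> strip_holomorphic r V ->
  cabs_continuous (fun x => V x%:C).
Proof.
move=> r0 [_ h] x e e0.
have [|d d0 Hd] := disc_algebra_continuous (h x) (z0 := x%:C) _ e0.
  by rewrite subrr Normc.normc0 ltW.
apply/nbhs_ballP; exists (Num.min d r); first by rewrite /= lt_min d0.
move=> y; rewrite -ball_normE /= lt_min distrC => /andP[yd yr].
by rewrite cabsC; apply: Hd; rewrite -rmorphB cabs_real// ltW.
Qed.

End ComplexContinuity.

(** * A lower bound for the Lyapunov exponent *)

Section LyapunovExponent.
Context {R : realType}.
Local Notation C := R[i].
Local Notation mu := (@lebesgue_measure R).
Local Notation D := (`[0, 1]%classic : set R).
Local Notation cint f := (\int[mu]_(x in D) f x).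
Local Notation cintegrable f := (mu.-integrable D (EFin \o f)).

Lemma ln_le_of_le (x y : R) : 0 < x -> x <= y -> ln x <= ln y.
Proof. by move=> x0 xy; rewrite ler_ln ?posrE// (lt_le_trans x0). Qed.

Lemma ln_le_of_le_mul (z x y : R) : 0 < z -> 0 < x -> 0 < y -> z <= x * y ->
  ln z <= ln x + ln y.
Proof. by move=> z0 x0 y0 zxy; rewrite -lnM ?posrE// ln_le_of_le. Qed.

Lemma measurable_ln_comp (f : R -> R) :
  measurable_fun setT f -> measurable_fun setT (fun x : R => ln (f x)).
Proof. by move=> mf; apply: measurableT_comp => //; exact: measurable_ln. Qed.

Lemma measurable_shift (t : R) (f : R -> R) :
  measurable_fun setT f -> measurable_fun setT (fun x : R => f (x + t)).
Proof.
move=> mf; apply: (@measurableT_comp _ _ _ _ _ _ f _ (fun x : R => x + t)) => //.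
exact: measurable_translation.
Qed.

Lemma measurable_invr_ge0 (f : R -> R) : (forall x, 0 <= f x) ->
  measurable_fun setT f -> measurable_fun setT (fun x => (f x)^-1).
Proof.
move=> f0 mf; under eq_fun do rewrite -powR_inv1//.
exact: (@measurableT_comp _ _ _ _ _ _ (fun z : R => z `^ (-1)) _ f).
Qed.

Section Growth.
Variables (la lv E omega : R) (a : R -> C) (v : R -> R).
Variables (V A Ac : C -> C) (s B : R).
Hypotheses (la0 : 0 < la) (lv0 : 0 < lv) (s0 : 0 < s) (B0 : 0 < B).
Hypotheses (hV : strip_holomorphic s V) (hA : strip_holomorphic s A)
  (hAc : strip_holomorphic s Ac).
Hypotheses (VB : forall z, `|Im z| <= s -> cabs (V z) <= B)
  (AB : forall z, `|Im z| <= s -> cabs (A z) <= B)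
  (AcB : forall z, `|Im z| <= s -> cabs (Ac z) <= B).
Hypotheses (Vv : forall x : R, V x%:C = (v x)%:C)
  (Aa : forall x : R, A x%:C = a x)
  (Aca : forall x : R, Ac x%:C = conjc (a x)).

Local Notation num := (jacobi_num la lv E omega a v).
Local Notation transfer := (jacobi_num_transfer la lv E omega a v).
Local Notation column := (jacobi_column la lv E omega V A Ac).
Let T : R := lv * B + `|E| + 2 * (la * B).

Let T0 : 0 < T.
Proof. by rewrite ltr_wpDr ?mulr_ge0 ?(ltW B0) ?(ltW la0)// ltr_wpDr// mulr_gt0. Qed.

Let a_periodic x : a (x + 1) = a x.
Proof. by rewrite -!Aa rmorphD rmorph1; have [->] := hA. Qed.

Let v_periodic x : v (x + 1) = v x.
Proof. by apply: complexI; rewrite -!Vv rmorphD rmorph1; have [->] := hV. Qed.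

Lemma jacobi_num_transfer_periodic n x : transfer n (x + 1) = transfer n x.
Proof.
apply: eq_bigr => k _; rewrite /jacobi_num addrAC.
by rewrite v_periodic a_periodic (addrAC _ 1) a_periodic.
Qed.

Lemma jacobi_num_transfer_continuous n i j :
  cabs_continuous (fun x => transfer n x i j).
Proof.
have ca : cabs_continuous a by exact: cabs_continuous_ext Aa (cabs_continuous_strip s0 hA).
have cv : cabs_continuous (fun x => (v x)%:C).
  exact: cabs_continuous_ext Vv (cabs_continuous_strip s0 hV).
have cc := @cabs_continuous_cst R.
have cnum k l : cabs_continuous (fun x => num x k l).
  apply: (@cabs_continuous_ext _ (fun x => if k == 0 then
      if l == 0 then lv%:C * (v x)%:C + - E%:C else - (la%:C * conjc (a x))
    else if l == 0 then la%:C * a (x + omega) else 0)).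
    by move=> x; rewrite mxE rmorphB rmorphM.
  case: (k == 0); case: (l == 0) => //.
  - by apply: cabs_continuousD => //; exact: cabs_continuousM.
  - by apply/cabs_continuousN/cabs_continuousM => //; exact: cabs_continuous_conj.
  - by apply: cabs_continuousM => //; exact: cabs_continuous_shift.
elim: n i j => [|n IH] i j.
  apply: (@cabs_continuous_ext _ (fun=> (1 : 'M[C]_2) i j)) => // x.
  by rewrite /jacobi_num_transfer big_nil.
apply: (@cabs_continuous_ext _ (fun x =>
    num (x + n.+1%:R * omega) i 0 * transfer n x 0 j +
    num (x + n.+1%:R * omega) i (lift 0 0) * transfer n x (lift 0 0) j)).
  by move=> x; rewrite jacobi_num_transferS -mulmxE [RHS]mxE !big_ord_recl big_ord0 addr0.
by apply: cabs_continuousD; apply: cabs_continuousM => //;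
  exact: (cabs_continuous_shift _ (cnum _ _)).
Qed.

Lemma opnorm_jacobi_num_transfer_le n x : opnorm (transfer n x) <= (T + 1) ^+ n.
Proof.
elim: n => [|n IH].
  rewrite /jacobi_num_transfer big_nil expr0; apply: opnorm_le => z z1.
  by rewrite mul1mx.
rewrite jacobi_num_transferS -mulmxE (le_trans (opnormM _ _))// exprS.
rewrite ler_pM ?opnorm_ge0// (le_trans (opnorm_le_entry_sum _))//.
rewrite /entry_sum !big_ord_recl !big_ord0 /jacobi_num /mx22 !mxE /=.
move: (x + _) => y; rewrite expr0n /= !addr0 sqrtr0 addr0 sqrtr_sqr.
have real0 (t : R) : `|Im t%:C| <= s by rewrite /= normr0 ltW.
have h1 : `|lv * v y - E| <= lv * B + `|E|.
  rewrite (le_trans (ler_normB _ _))// lerD2r normrM gtr0_norm// ler_pM2l//.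
  by rewrite -cabs_real -Vv VB.
have h2 t : cabs (la%:C * a t) <= la * B.
  by rewrite Normc.normcM cabs_real_ge0 ?(ltW la0)// ler_pM2l// -Aa AB.
have h3 : cabs (- (la%:C * conjc (a y))) <= la * B.
  by rewrite cabsN Normc.normcM cabs_real_ge0 ?(ltW la0)// ler_pM2l// -Aca AcB.
have := h2 (y + omega); rewrite /T; lra.
Qed.

Let alpha n (x : R) : R := ln (opnorm (transfer n x)).

Let measurable_opnorm_transfer n :
  measurable_fun setT (fun x => opnorm (transfer n x)).
Proof.
apply: continuous_measurable_fun; apply: continuous_opnorm => i j x e e0.
exact: jacobi_num_transfer_continuous.
Qed.

Let measurable_alpha n : measurable_fun setT (alpha n).
Proof. exact: measurable_ln_comp. Qed.

Let alpha_periodic n : periodic (alpha n) 1.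
Proof. by move=> x; rewrite /alpha jacobi_num_transfer_periodic. Qed.

(** The norm of the product is bounded below by its top left entry only. *)
Let p n (x : R) : R := cabs (column n x%:C).1.

Let p_le_opnorm n x : p n x <= opnorm (transfer n x).
Proof.
rewrite /p (jacobi_column_real _ _ _ _ _ _ Vv Aa Aca).
exact: cabs_entry_le_opnorm.
Qed.

Let alpha_le n x : alpha n x <= n%:R * ln (T + 1).
Proof.
have T1 : 1 <= T + 1 by rewrite lerDr ltW.
have U0 : 0 <= n%:R * ln (T + 1) by rewrite mulr_ge0// ln_ge0.
rewrite /alpha; have [->|o0] := eqVneq (opnorm (transfer n x)) 0.
  by rewrite ln0.
have op : 0 < opnorm (transfer n x) by rewrite lt_neqAle eq_sym o0 opnorm_ge0.
rewrite (le_trans (ln_le_of_le op (opnorm_jacobi_num_transfer_le n x)))//.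
by rewrite lnXn ?mulr_natl// ltr_wpDl// ltW.
Qed.

Variables (d y ya da : R).
Hypotheses (y0 : 0 < y) (ys : 2 * y < s) (lad : la * B <= lv * d / 2).
Hypothesis Vd : forall z, Im z = y -> lv * d <= cabs (lv%:C * V z - E%:C).
Hypotheses (ya0 : 0 < ya) (yas : 2 * ya < s) (da0 : 0 < da).
Hypothesis Ad : forall z, Im z = ya -> da <= cabs (A z).

(** The three-lines bound for one step: (lv d / 2) ^ n at height y against T ^ n
at height 2 y. *)
Let rate : R := 2 * ln (lv * d / 2) - ln T.

Let Im_in (t : R) z : 0 < t -> 2 * t < s -> Im z = t -> `|Im z| <= s.
Proof. by move=> t0 ts ->; rewrite gtr0_norm//; lra. Qed.

Let p_integrable n : [/\ \forall x \ae mu, D x -> (column n x%:C).1 != 0,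
   cintegrable (fun x => ln (p n x)) & n%:R * rate <= cint (fun x => ln (p n x))].
Proof.
have [hp _] := jacobi_column_strip la lv E omega n hV hA hAc.
have g0 : 0 < lv * d / 2 by apply: lt_le_trans lad; rewrite mulr_gt0.
have m0 : 0 < (lv * d / 2) ^+ n by rewrite exprn_gt0.
have M0 : 0 < T ^+ n by rewrite exprn_gt0.
have [||nz ip lb] := ln_cabs_integrable hp y0 ys m0 M0.
- move=> z zy.
  have Ay w : Im w = y -> cabs (A w) <= B by move=> wy; apply: AB; exact: Im_in wy.
  have Acy w : Im w = y -> cabs (Ac w) <= B by move=> wy; apply: AcB; exact: Im_in wy.
  by have [] := jacobi_column_ge omega la0 B0 n Ay Acy Vd lad zy.
- move=> z zy; have zs : `|Im z| <= s.
    by rewrite zy gtr0_norm ?mulr_gt0// ltW.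
  have := jacobi_column_le E omega la0 lv0 B0 n VB AB AcB zs.
  by apply: le_trans; rewrite lerDl cabs_ge0.
split=> //; apply: le_trans lb.
by rewrite (lnXn n g0) (lnXn n T0) mulrnAr -mulrnBl -/rate mulr_natl.
Qed.

Let measurable_ln_p n : measurable_fun setT (fun x => ln (p n x)).
Proof.
apply: measurable_ln_comp.
have [hp _] := jacobi_column_strip la lv E omega n hV hA hAc.
exact: (continuous_measurable_fun (strip_real_continuous s0 hp)).
Qed.

(** Bounded above uniformly, and below by log p_n almost everywhere. *)
Let alpha_integrable n : cintegrable (alpha n).
Proof.
have [nz ip _] := p_integrable n.
have T1 : 1 <= T + 1 by rewrite lerDr ltW.
have U0 : 0 <= n%:R * ln (T + 1) by rewrite mulr_ge0// ln_ge0.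
have icst : cintegrable (fun=> n%:R * ln (T + 1)).
  by apply: circle_integrable_continuous; exact: cst_continuous.
have mlnp := measurable_ln_p n.
apply: (@ae_circle_integrable_le _ _
  (fun x => `|ln (p n x)| + n%:R * ln (T + 1))) => //.
- apply: measurable_funD => //; exact: measurableT_comp.
- exact: (circle_integrableD (integrable_norm ip) icst).
apply: ae_imply nz => x nzx Dx; have := nzx Dx; rewrite -cabs_gt0 => p0.
have h1 : ln (p n x) <= alpha n x by exact: ln_le_of_le (p_le_opnorm n x).
have h2 := alpha_le n x; rewrite ler_norml.
have := ler_norm (ln (p n x)); have := ler_norm (- ln (p n x)).
by rewrite normrN; lra.
Qed.

Let alpha_lower n : n%:R * rate <= cint (alpha n).
Proof.
have [nz ip lb] := p_integrable n; apply: (le_trans lb).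
have mlnp := measurable_ln_p n.
apply: ae_le_circle_integral => //.
apply: ae_imply nz => x nzx Dx; have := nzx Dx; rewrite -cabs_gt0 => p0.
exact: ln_le_of_le (p_le_opnorm n x).
Qed.

(** Submultiplicativity of the norm survives the logarithm only where the norm of
the product is nonzero, because ln 0 = 0; p_n ensures this almost everywhere. *)
Let alpha_subadditive n m : cint (alpha (n + m)) <= cint (alpha n) + cint (alpha m).
Proof.
have ash := circle_integral_shift (m%:R * omega) (measurable_alpha n)
  (@alpha_periodic n).
rewrite -[X in _ <= X + _]ash.
have ish := circle_integrable_shift (m%:R * omega) (measurable_alpha n)
  (@alpha_periodic n) (alpha_integrable n).
have msh : measurable_fun setT (fun x : R => alpha n (x + m%:R * omega)).
  exact: measurable_shift.
rewrite -(circle_integralD ish (alpha_integrable m)).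
apply: (ae_le_circle_integral (measurable_alpha (n + m))
  (measurable_funD msh (measurable_alpha m)) (alpha_integrable (n + m))
  (circle_integrableD ish (alpha_integrable m))).
have [nz _ _] := p_integrable (n + m).
apply: ae_imply nz => x nzx Dx; have := nzx Dx; rewrite -cabs_gt0 => p0.
have o0 := lt_le_trans p0 (p_le_opnorm (n + m) x).
have := o0; rewrite jacobi_num_transferD -mulmxE => o1.
have o2 := lt_le_trans o1 (opnormM _ _).
have on : 0 < opnorm (transfer n (x + m%:R * omega)).
  rewrite lt_neqAle eq_sym opnorm_ge0 andbT; apply/eqP => on.
  by rewrite on mul0r ltxx in o2.
have om : 0 < opnorm (transfer m x).
  rewrite lt_neqAle eq_sym opnorm_ge0 andbT; apply/eqP => om.
  by rewrite om mulr0 ltxx in o2.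
have op_le : opnorm (transfer (n + m) x) <=
    opnorm (transfer n (x + m%:R * omega)) * opnorm (transfer m x).
  by rewrite jacobi_num_transferD -mulmxE opnormM.
exact: (ln_le_of_le_mul o0 on om op_le).
Qed.

Let ell (x : R) : R := ln (cabs (la%:C * a x)).
Let J : R := cint ell.

Let laA_strip t : strip_holomorphic s (fun z => la%:C * A (z + t%:C)).
Proof. by apply: stripM; [exact: strip_cst|exact: strip_shift]. Qed.

Let a_shift_integrable (t : R) :
  (\forall x \ae mu, D x -> la%:C * a (x + t) != 0) /\
  cintegrable (fun x => ell (x + t)).
Proof.
have m0 : 0 < la * da by rewrite mulr_gt0.
have M0 : 0 < la * B by rewrite mulr_gt0.
have [||nz ia _] := ln_cabs_integrable (laA_strip t) ya0 yas m0 M0.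
- move=> z zy; rewrite Normc.normcM cabs_real_ge0 ?(ltW la0)// ler_pM2l//.
  by rewrite Ad// Im_add_real.
- move=> z zy; rewrite Normc.normcM cabs_real_ge0 ?(ltW la0)// ler_pM2l//.
  by rewrite AB// Im_add_real zy gtr0_norm ?mulr_gt0// ltW.
have E1 : (fun x => ell (x + t)) = (fun x => ln (cabs (la%:C * A (x%:C + t%:C)))).
  by apply/funext => x; rewrite /ell -rmorphD Aa.
rewrite E1; split=> //.
by apply: ae_imply nz => x nz /nz; rewrite -rmorphD Aa.
Qed.

Let continuous_laa : continuous (fun x => cabs (la%:C * a x)).
Proof.
have := strip_real_continuous s0 (laA_strip 0).
by under eq_fun do rewrite -rmorphD addr0 Aa.
Qed.

Let measurable_ell : measurable_fun setT ell.
Proof.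
apply: measurable_ln_comp.
exact: continuous_measurable_fun.
Qed.

Let ell_shift t : cint (fun x => ell (x + t)) = J.
Proof.
by apply: circle_integral_shift => // x; rewrite /ell a_periodic.
Qed.

Let psi n (x : R) : R := ln (opnorm (jacobi_transfer la a lv v n x E omega)).

Let psiE n x : psi n x = ln ((\prod_(k <- iota 1 n)
  (cabs (la%:C * a (x + (k%:R * omega + omega))))^-1) * opnorm (transfer n x)).
Proof.
rewrite /psi jacobi_transferE opnormZ cabs_prod; congr (ln (_ * _)).
by apply: eq_bigr => k _; rewrite Normc.normcV addrA.
Qed.

Let measurable_psi n : measurable_fun setT (psi n).
Proof.
rewrite (funext (psiE n)).
apply: measurable_ln_comp; apply: measurable_funM => //.
elim: (iota 1 n) => [|k l IH].
  by under eq_fun do rewrite big_nil; exact: measurable_cst.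
under eq_fun do rewrite big_cons; apply: measurable_funM => //.
apply: measurable_invr_ge0 => [x|]; first exact: cabs_ge0.
apply: (@measurable_shift _ (fun x => cabs (la%:C * a x))).
exact: continuous_measurable_fun.
Qed.

Let ln_prod_inv (l : seq nat) (c : nat -> R) : (forall k, 0 < c k) ->
  0 < \prod_(k <- l) (c k)^-1 /\
  ln (\prod_(k <- l) (c k)^-1) = - \sum_(k <- l) ln (c k).
Proof.
move=> c0; elim: l => [|k l [IH1 IH2]].
  by rewrite !big_nil ln1 oppr0 ltr01.
rewrite !big_cons; have i0 : 0 < (c k)^-1 by rewrite invr_gt0.
split; first exact: mulr_gt0.
by rewrite lnM ?posrE// lnV ?posrE// IH2 opprD.
Qed.

(** Each denominator is a translate of la a and contributes the same mean J of
log |la a|.  The logarithm of the product splits where no denominator and no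
norm vanishes, that is almost everywhere. *)
Let integral_psi n :
  (\int[mu]_(x in D) (psi n x)%:E = (cint (alpha n) - n%:R * J)%:E)%E.
Proof.
pose g x := alpha n x - \sum_(k <- iota 1 n) ell (x + (k%:R * omega + omega)).
have il k : cintegrable (fun x => ell (x + (k%:R * omega + omega))).
  by have [] := a_shift_integrable (k%:R * omega + omega).
have isum := circle_integrable_sum (iota 1 n) il.
have ig : cintegrable g by exact: circle_integrableB.
have mg : measurable_fun setT g.
  apply: measurable_funB => //.
  elim: (iota 1 n) => [|k l IH].
    by under eq_fun do rewrite big_nil; exact: measurable_cst.
  under eq_fun do rewrite big_cons; apply: measurable_funD => //.
  exact: measurable_shift.
have Ig : cint g = cint (alpha n) - n%:R * J.
  rewrite /g (circle_integralB (alpha_integrable n) isum); congr (_ - _).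
  rewrite (circle_integral_sum _ il).
  under eq_bigr do rewrite ell_shift.
  by rewrite big_const_seq count_predT size_iota iter_addr_0 mulr_natl.
rewrite -Ig -(circle_integral_EFin ig).
apply: (ae_eq_circle_integral_EFin (measurable_psi n) mg).
have nza : \forall x \ae mu, forall k : nat,
    D x -> la%:C * a (x + (k%:R * omega + omega)) != 0.
  by apply: ae_forall_nat => k; have [] := a_shift_integrable (k%:R * omega + omega).
have [nzp _ _] := p_integrable n.
apply: ae_imply (ae_and nza nzp) => x [nz1 nz2] Dx; rewrite psiE /g.
have o0 : 0 < opnorm (transfer n x).
  by apply: lt_le_trans (p_le_opnorm n x); rewrite cabs_gt0 nz2.
have [c0 cE] := @ln_prod_inv (iota 1 n)
  (fun k => cabs (la%:C * a (x + (k%:R * omega + omega))))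
  (fun k => etrans (cabs_gt0 _) (nz1 k Dx)).
by rewrite lnM ?posrE// cE addrC.
Qed.

(** The heights y and ya may differ: the first one serves V - E / lv, the second
one only ensures that log |a| is integrable. *)
Lemma lyapunov_lower_bound :
  ((2 * ln (lv * d / 2) - ln T - J)%:E <= lyapunov la a lv v E omega)%E.
Proof.
have [l rl cl] := subadditive_cvg alpha_subadditive alpha_lower.
rewrite /lyapunov.
have cvgE : ((n%:R^-1)%:E * \int[mu]_(x in `[0%R, 1%R])
    (ln (opnorm (jacobi_transfer la a lv v n x E omega)))%:E)%E @[n --> \oo]
    --> (l - J)%:E.
  have : (cint (alpha n) / n%:R - J)%:E @[n --> \oo] --> (l - J)%:E.
    by apply: cvg_EFin; [exact: nearW|apply: cvgB => //; exact: cvg_cst].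
  apply: cvg_trans; apply: near_eq_cvg; near=> n.
  rewrite -[X in (_ * X)%E]/(\int[mu]_(x in D) (psi n x)%:E)%E integral_psi -EFinM.
  congr EFin; have n0 : (0 : R) < n%:R by rewrite ltr0n; near: n; exact: nbhs_infty_gt.
  by field; rewrite gt_eqF.
rewrite (cvg_lim _ cvgE)// lee_fin lerD2r.
exact: rl.
Unshelve. all: by end_near. Qed.

End Growth.
End LyapunovExponent.

(** * Large coupling *)

Theorem theorem5 (R : realType) (v : R -> R) (a : R -> R[i]) (la gamma : R) :
  analytic_circle_real v ->
  (exists x y : R, v x <> v y) ->
  analytic_circle_complex a ->
  (exists x : R, a x <> 0) ->
  0 < la ->
  0 < gamma < 1 ->
  exists lp : R, forall lv E omega : R,
    0 < lv ->
    irrational omega ->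
    energy_interval la a lv v E ->
    lp < lv ->
    (((1 - gamma) * ln lv)%:E < lyapunov la a lv v E omega)%E.
Proof.
move=> v_an v_nonconst a_an a_nonzero la0 /andP[g0 g1].
have vp : periodic (fun x => (v x)%:C) 1.
  by move=> x; have [->] := v_an.
have ap : periodic a 1 by have [] := a_an.
have acp : periodic (fun x => conjc (a x)) 1 by move=> x; rewrite ap.
have aps := locally_power_series_complex a_an.
have [rV rV0 [V hV Vv]] := analytic_strip_extension vp (locally_power_series_real v_an).
have [rA rA0 [A hA Aa]] := analytic_strip_extension ap aps.
have [rC rC0 [Ac hAc Aca]] := analytic_strip_extension acp (locally_power_series_conj aps).
have [sV /andP[sV0 sVr] [BV BV0 VB]] := strip_bounded rV0 hV.
have [sA /andP[sA0 sAr] [BA BA0 AB]] := strip_bounded rA0 hA.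
have [sC /andP[sC0 sCr] [BC BC0 AcB]] := strip_bounded rC0 hAc.
pose s := Num.min sV (Num.min sA sC); have s0 : 0 < s by rewrite !lt_min sV0 sA0.
have [sV' sA' sC'] : [/\ s <= sV, s <= sA & s <= sC].
  by rewrite !ge_min !lexx !orbT.
have {}hV : strip_holomorphic s V by apply: strip_sub hV; exact: le_trans sVr.
have {}hA : strip_holomorphic s A by apply: strip_sub hA; exact: le_trans sAr.
have {}hAc : strip_holomorphic s Ac by apply: strip_sub hAc; exact: le_trans sCr.
pose B := BV + BA + BC; have B0 : 0 < B by rewrite !addr_gt0.
have {}VB z : `|Im z| <= s -> cabs (V z) <= B.
  move=> zs; have := VB z (le_trans zs sV').
  by rewrite /B; lra.
have {}AB z : `|Im z| <= s -> cabs (A z) <= B.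
  move=> zs; have := AB z (le_trans zs sA').
  by rewrite /B; lra.
have {}AcB z : `|Im z| <= s -> cabs (Ac z) <= B.
  move=> zs; have := AcB z (le_trans zs sC').
  by rewrite /B; lra.
have s20 : 0 < s / 2 by rewrite divr_gt0.
have [|ya /andP[ya0 yas] [da da0 Ad]] := strip_zero_free_line s0 s20 hA.
  by have [x ax] := a_nonzero; exists x; rewrite Aa.
(* E / lv ranges over [- K, K] for every lv >= 1. *)
pose K := `|2 * la * Linfty_circle (fun x => cabs (a x))| +
          `|Linfty_circle (fun x => `|v x|)|.
have [|d d0 Vd] := strip_value_free_lines (- K) K s0 s20 hV.
  have [x [x' xx']] := v_nonconst; exists x, x'.
  by rewrite !Vv => /complexI.
pose Cc := B + K + 2 * (la * B).
have K0 : 0 <= K by rewrite addr_ge0.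
have Cc0 : 0 < Cc by rewrite /Cc ltr_wpDr ?mulr_ge0 ?(ltW la0) ?(ltW B0)// ltr_wpDr.
pose J := \int[@lebesgue_measure R]_(x in `[0, 1]%classic) ln (cabs (la%:C * a x)).
pose Cst := J + ln Cc - 2 * ln (d / 2).
(* The three thresholds: E / lv in [- K, K]; domination of the off-diagonal
   terms on the line; gamma log lv beyond the constant Cst. *)
exists (Num.max (Num.max 1 (2 * (la * B) / d)) (expR (Cst / gamma))).
move=> lv E omega lv0 _; rewrite /energy_interval /= in_itv /= => Eb.
rewrite !gt_max -andbA => /and3P[lv1 lvd lvC].
have Eabs : `|E| <= lv * K.
  have EL : `|E| <= 2 * la * Linfty_circle (fun x => cabs (a x)) +
      lv * Linfty_circle (fun x => `|v x|) by rewrite ler_norml.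
  apply: (le_trans EL); rewrite /K mulrDr lerD//.
    rewrite (le_trans (ler_norm _))// ler_peMl//; exact: ltW.
  by rewrite ler_pM2l// ler_norm.
have [|y /andP[y0 ys] Vdy] := Vd (E / lv).
  by rewrite -ler_norml normrM normfV (gtr0_norm lv0) ler_pdivrMr// mulrC.
have lad : la * B <= lv * d / 2.
  by move: lvd; rewrite ltr_pdivrMr//; lra.
have {Vdy} Vdy z : Im z = y -> lv * d <= cabs (lv%:C * V z - E%:C).
  move=> /Vdy h; have -> : lv%:C * V z - E%:C = lv%:C * (V z - (E / lv)%:C).
    by rewrite mulrBr -rmorphM mulrCA divff ?mulr1// gt_eqF.
  by rewrite Normc.normcM cabs_real_ge0 ?(ltW lv0)// ler_pM2l.
have ys' : 2 * y < s by lra.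
have yas' : 2 * ya < s by lra.
have := lyapunov_lower_bound omega la0 lv0 s0 B0 hV hA hAc VB AB AcB Vv Aa Aca
  y0 ys' lad Vdy ya0 yas' da0 Ad.
apply: lt_le_trans; rewrite lte_fin -/J.
have T0 : 0 < lv * B + `|E| + 2 * (la * B).
  by rewrite ltr_wpDr ?mulr_ge0 ?(ltW la0) ?(ltW B0)// ltr_wpDr// mulr_gt0.
have lnT : ln (lv * B + `|E| + 2 * (la * B)) <= ln lv + ln Cc.
  have lB0 : 0 <= 2 * (la * B) by rewrite !mulr_ge0// ltW.
  apply: ln_le_of_le_mul => //.
  rewrite (mulrDr lv (B + K)) (mulrDr lv B) lerD ?lerD2l//.
  by rewrite ler_peMl// ltW.
have lnd : ln (lv * d / 2) = ln lv + ln (d / 2).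
  by rewrite -mulrA lnM ?posrE ?divr_gt0.
have : Cst < gamma * ln lv.
  by rewrite mulrC -ltr_pdivrMr// -ltr_expR lnK ?posrE.
rewrite /Cst lnd; lra.
Qed.
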